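(* Let $M$ be a manifold, $E$ an oriented vector bundle over $M$ of rank $4n$, $h$ a neutral metric of $E$, and $\nabla$ an $h$-connection of $E$ (a connection with $\nabla h=0$). Let $\varepsilon\in\{+,-\}$ and let $N$ be an $\varepsilon$-nilpotent structure of $(E,h)$. Let $\hat\nabla$ denote the connections of $\bigwedge^2E$ and of $\bigwedge^{2n}E$ induced by $\nabla$. Then the following hold: (a) $N$ satisfies the Walker condition with respect to $\nabla$ if and only if $\hat\nabla\xi_N=\alpha\otimes\xi_N$ for a $1$-form $\alpha$ on $M$; (b) $N$ is parallel with respect to $\nabla$ (that is, $\nabla N=0$) if and only if the corresponding section $\Theta_N$ of $\bigwedge^2\pi_N$ satisfies $\hat\nabla\Theta_N=0$; and if one of these two conditions holds, then $\hat\nabla\xi_N=0$, and therefore $N$ satisfies the Walker condition with respect to $\nabla$.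
   Context: Everything is smooth. $h$ neutral means that $h$ is a bundle metric of signature $(2n,2n)$. An ordered pseudo-orthonormal local frame field $e=(e_1,\dots,e_{4n})$ of $(E,h)$ always has $e_1,\dots,e_{2n}$ space-like ($h(e_i,e_i)=1$) and $e_{2n+1},\dots,e_{4n}$ time-like ($h(e_i,e_i)=-1$). Set $I_{1,\pm}:=\pm1$ and $I_{n,\pm}:={\rm diag}(\pm1,1,\dots,1)$ ($n\times n$) for $n\ge2$; $I'_{4n,\varepsilon}:={\rm diag}(I_n,I_n,I_n,I_{n,\varepsilon})$ (block diagonal), and $$\Lambda_n:=\left[\begin{array}{cccc}O_n&-I_n&O_n&I_n\\ I_n&O_n&I_n&O_n\\ O_n&I_n&O_n&-I_n\\ I_n&O_n&I_n&O_n\end{array}\right],$$ with $I_n$, $O_n$ the $n\times n$ unit and zero matrices. A section $N$ of ${\rm End}\,E$ is an $\varepsilon$-nilpotent structure of $(E,h)$ if on a neighborhood of each point of $M$ there is an ordered pseudo-orthonormal local frame field $e$ of $(E,h)$ giving the orientation of $E$ with $NeI'_{4n,\varepsilon}=eI'_{4n,\varepsilon}\Lambda_n$ (frames are treated as row vectors). Then $\pi_N:={\rm Im}\,N={\rm Ker}\,N$ is a subbundle of $E$ of rank $2n$ on which $h$ vanishes. $N$ satisfies the Walker condition with respect to $\nabla$ if for any local section $\psi$ of $\pi_N$, $\nabla\psi$ is a $1$-form valued in $\pi_N$. Let $h^*$ be the metric of the dual bundle $E^*$ induced by $h$, and $N^*\phi^*:=\phi^*\circ N$ for local sections $\phi^*$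 of $E^*$. The section $\Theta_N$ of $\bigwedge^2E$ is defined by $\Theta_N(\phi^*,\psi^* ):=h^*(\phi^*,N^*\psi^* )$ (sections of $\bigwedge^2E$ being viewed as alternating bilinear forms on $E^*$, with $(a\wedge b)(\phi^*,\psi^* )=\phi^*(a)\psi^*(b)-\psi^*(a)\phi^*(b)$); it is a section of $\bigwedge^2\pi_N$, and $\xi_N:=\frac{(-1)^{n(n-1)/2}}{n!}\Theta_N^n$ ($n$-fold exterior power) is a nowhere zero section of $\bigwedge^{2n}\pi_N$. *)

(* Defs.v *)
(* MathComp-Analysis; everything is over a [realType] R.
   Neither manifolds, vector bundles nor connections are in the library, so
   they are set up here in their textbook form:
   - a manifold carries an atlas of charts with smooth transitions;
   - tangent vectors are derivations of germs of smooth functions;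
   - a vector bundle is a family of vector spaces with local frame fields
     whose transition matrices are smooth;
   - a connection is a local operator on (germs of) smooth sections. *)
From HB Require Import structures.
From mathcomp Require Import all_boot all_order all_algebra all_fingroup.
From mathcomp Require Import all_classical all_reals all_analysis.

Set Implicit Arguments.
Unset Strict Implicit.
Unset Printing Implicit Defensive.

Import Order.TTheory GRing.Theory Num.Theory.
Import numFieldNormedType.Exports.

Local Open Scope classical_set_scope.
Local Open Scope ring_scope.

Section SmoothManifold.
Variable R : realType.

(* [U] is meant to be open. *)
Fixpoint Ck (m k : nat) (U : set 'rV[R]_m) (f : 'rV[R]_m -> R) : Prop :=
  match k with
  | 0%N => forall x, U x -> {for x, continuous f}
  | k'.+1 => (forall x, U x -> differentiable f x) /\
             (forall v : 'rV[R]_m, Ck k' U (fun x => 'D_v f x))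
  end.

Definition Cinfty (m : nat) (U : set 'rV[R]_m) (f : 'rV[R]_m -> R) : Prop :=
  forall k, Ck k U f.

(* A homeomorphism from the open set [cdom] onto an open subset of R^m; [cmap]
   and [cinv] are total, their values elsewhere are irrelevant. *)
Record chart (T : topologicalType) (m : nat) := Chart {
  cdom : set T;
  cmap : T -> 'rV[R]_m;
  cinv : 'rV[R]_m -> T;
  cdom_open : open cdom;
  cimg_open : open (cmap @` cdom);
  cmapK : forall x, cdom x -> cinv (cmap x) = x;
  cmap_continuous : forall x, cdom x -> {for x, continuous cmap};
  cinv_continuous : forall y, (cmap @` cdom) y -> {for y, continuous cinv}
}.

Record manifold (m : nat) := Manifold {
  mcarrier :> topologicalType;
  manifold_hausdorff : hausdorff_space mcarrier;
  manifold_second_countable : @second_countable mcarrier;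
  atlas : set (chart mcarrier m);
  atlas_cover : forall x, exists2 c, atlas c & cdom c x;
  atlas_smooth : forall c d, atlas c -> atlas d -> forall i : 'I_m,
    Cinfty (cmap c @` (cdom c `&` cdom d))
           (fun y => cmap d (cinv c y) ord0 i)
}.

Variables (m : nat) (M : manifold m).

Definition smooth_on (U : set M) (f : M -> R) : Prop :=
  forall c, atlas c -> Cinfty (cmap c @` (cdom c `&` U)) (f \o cinv c).

Definition smooth_near (f : M -> R) (x : M) : Prop :=
  exists U : set M, [/\ open U, U x & smooth_on U f].

(* A derivation of the germs at x of smooth functions, extended by 0 to the
   functions that are not smooth near x, so that equality of tangent vectors is
   equality of derivations. *)
Record tangent (x : M) := Tangent {
  tact :> (M -> R) -> R;
  tact_local : forall f g, smooth_near f x -> smooth_near g x ->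
    (\forall y \near x, f y = g y) -> tact f = tact g;
  tact_linear : forall (a : R) f g, smooth_near f x -> smooth_near g x ->
    tact (fun y => a * f y + g y) = a * tact f + tact g;
  tact_leibniz : forall f g, smooth_near f x -> smooth_near g x ->
    tact (fun y => f y * g y) = f x * tact g + g x * tact f;
  tact_junk : forall f, ~ smooth_near f x -> tact f = 0
}.

(* w = a u + v in the tangent space at x *)
Definition tangent_comb (x : M) (a : R) (u v w : tangent x) : Prop :=
  forall f, w f = a * u f + v f.

Definition smooth_field (U : set M) (X : forall x : M, tangent x) : Prop :=
  forall (W : set M) (f : M -> R), open W -> W `<=` U -> smooth_on W f ->
    smooth_on W (fun x => X x f).

Record one_form := OneForm {
  form_at :> forall x : M, tangent x -> R;
  form_linear : forall (x : M) (a : R) (u v w : tangent x),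
    tangent_comb a u v w -> form_at w = a * form_at u + form_at v;
  form_smooth : forall (U : set M) (X : forall x : M, tangent x),
    open U -> smooth_field U X -> smooth_on U (fun x => form_at (X x))
}.

End SmoothManifold.

Section VectorBundle.
Variables (R : realType) (m : nat) (M : manifold R m) (r : nat).

(* The frame field [bframe a] is meaningful over [bdom a] only. The covering
   condition is given by an index [bat x] for every x: it only serves to choose
   extensions of vectors to local sections, on which nothing depends. *)
Record vbundle := VBundle {
  fib :> M -> vectType R;
  bidx : Type;
  bdom : bidx -> set M;
  bframe : bidx -> forall x : M, r.-tuple (fib x);
  bat : M -> bidx;
  bdom_open : forall a, open (bdom a);
  bdom_bat : forall x, bdom (bat x) x;
  bframe_basis : forall a x, bdom a x -> basis_of fullv (bframe a x);
  bframe_smooth : forall a b (i j : 'I_r),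
    smooth_on (bdom a `&` bdom b)
              (fun x => coord (bframe a x) i (tnth (bframe b x) j))
}.

Variable E : vbundle.

Definition section := forall x : M, E x.

Definition smooth_section (U : set M) (s : section) : Prop :=
  forall (a : bidx E) (i : 'I_r),
    smooth_on (U `&` bdom a) (fun x => coord (bframe a x) i (s x)).

Definition smooth_section_near (s : section) (x : M) : Prop :=
  exists U : set M, [/\ open U, U x & smooth_section U s].

Definition frame_field (U : set M) (e : forall x : M, r.-tuple (E x)) : Prop :=
  (forall x, U x -> basis_of fullv (e x)) /\
  (forall i : 'I_r, smooth_section U (fun x => tnth (e x) i)).

Record orientation := Orientation {
  positive : forall x : M, r.-tuple (E x) -> Prop;
  positive_basis : forall x (b : r.-tuple (E x)),
    positive b -> basis_of fullv b;
  positive_det : forall x (b b' : r.-tuple (E x)),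
    positive b -> basis_of fullv b' ->
    (positive b' <-> 0 < \det (\matrix_(i, j) coord b i (tnth b' j)));
  positive_local : forall x : M, exists (U : set M) e,
    [/\ open U, U x, frame_field U e & forall y, U y -> positive (e y)]
}.

Definition dual (V : vectType R) : vectType R := 'Hom(V, R^o).

(* a section of E^* *)
Definition cosection := forall x : M, dual (E x).

Definition smooth_cosection_near (phi : cosection) (x : M) : Prop :=
  exists U : set M, [/\ open U, U x & forall (a : bidx E) (i : 'I_r),
    smooth_on (U `&` bdom a) (fun y => phi y (tnth (bframe a y) i))].

Record connection := Connection {
  conn :> section -> forall x : M, tangent x -> E x;
  conn_local : forall s t x (v : tangent x),
    smooth_section_near s x -> smooth_section_near t x ->
    (\forall y \near x, s y = t y) -> conn s v = conn t v;
  conn_add : forall s t x (v : tangent x),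
    smooth_section_near s x -> smooth_section_near t x ->
    conn (fun y => s y + t y) v = conn s v + conn t v;
  conn_leibniz : forall (f : M -> R) s x (v : tangent x),
    smooth_near f x -> smooth_section_near s x ->
    conn (fun y => f y *: s y) v = v f *: s x + f x *: conn s v;
  conn_tensorial : forall s x (a : R) (u v w : tangent x),
    smooth_section_near s x -> tangent_comb a u v w ->
    conn s w = a *: conn s u + conn s v;
  conn_smooth : forall (U : set M) s (X : forall x : M, tangent x),
    open U -> smooth_section U s -> smooth_field U X ->
    smooth_section U (fun x => conn s (X x))
}.

(* A field of bilinear forms is given by the maps u |-> h(u, -). *)
Definition bilinear_field := forall x : M, 'Hom(E x, dual (E x)).

Definition smooth_bilinear (h : bilinear_field) : Prop :=
  forall (U : set M) (s t : section), open U ->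
    smooth_section U s -> smooth_section U t ->
    smooth_on U (fun x => h x (s x) (t x)).

(* nabla h = 0 *)
Definition metric_connection (h : bilinear_field) (nabla : connection) : Prop :=
  forall (s t : section) (x : M) (v : tangent x),
    smooth_section_near s x -> smooth_section_near t x ->
    v (fun y => h y (s y) (t y) : R) =
      h x (nabla s x v) (t x) + h x (s x) (nabla t x v).

Definition endo_field := forall x : M, 'End(E x).

Definition smooth_endo (N : endo_field) : Prop :=
  forall (U : set M) (s : section), open U -> smooth_section U s ->
    smooth_section U (fun x => N x (s x)).

(* nabla N = 0 *)
Definition parallel_endo (nabla : connection) (N : endo_field) : Prop :=
  forall (s : section) (x : M) (v : tangent x), smooth_section_near s x ->
    nabla (fun y => N y (s y)) x v - N x (nabla s x v) = 0.

(* limg (N x) is the fibre of pi_N at x. *)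
Definition walker (nabla : connection) (N : endo_field) : Prop :=
  forall (U : set M) (s : section), open U -> smooth_section U s ->
    (forall x, U x -> s x \in limg (N x)) ->
    forall x (v : tangent x), U x -> nabla s x v \in limg (N x).

(* w extended with constant coordinates in the chosen frame field around x *)
Definition extend (x : M) (w : E x) : section :=
  fun y => \sum_(i < r)
    coord (bframe (bat E x) x) i w *: tnth (bframe (bat E x) y) i.

(* (nabla^*_v phi)(w) = v(phi(s)) - phi(nabla_v s) for any local section s with
   s(x) = w; this does not depend on s when phi is smooth near x, and
   [extend w] is one choice. *)
Definition dual_conn (nabla : connection) (phi : cosection) (x : M)
    (v : tangent x) : dual (E x) :=
  linfun (fun w : E x => (v (fun y => phi y (extend w y) : R)
                          - phi x (nabla (extend w) x v)) : R^o).

(* The k-th exterior power of V is the space of alternating k-linear forms on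
   V^*, inside the space [multiform V k] of all functions of k covectors. *)
Definition multiform (V : vectType R) (k : nat) := ('I_k -> dual V) -> R.

(* With this normalization (a_1 ^ ... ^ a_k)(phi) = det (phi_i(a_j)); for k = 2,
   (a ^ b)(phi, psi) = phi(a) psi(b) - psi(a) phi(b). *)
Definition wedge (V : vectType R) (k l : nat)
    (a : multiform V k) (b : multiform V l) : multiform V (k + l) :=
  fun phi => ((k`! * l`!)%:R)^-1 *
    \sum_(s : {perm 'I_(k + l)}) (-1) ^+ s *
      a (fun i => phi (s (lshift l i))) * b (fun j => phi (s (rshift k j))).

(* [(p.+1 * k)%N] is convertible to [(k + p * k)%N]. *)
Fixpoint wedge_power (V : vectType R) (k : nat) (a : multiform V k) (p : nat)
    : multiform V (p * k) :=
  match p return multiform V (p * k) with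
  | 0%N => fun _ => 1
  | p'.+1 => wedge a (@wedge_power V k a p')
  end.
Arguments wedge_power [V k] a p _.

Definition multiform_field (k : nat) := forall x : M, multiform (E x) k.

(* The induced connection on exterior powers, evaluated on local sections
   phi_1, ..., phi_k of E^*:
   v(w(phi_1, ..., phi_k)) - sum_i w(phi_1, ..., nabla^*_v phi_i, ..., phi_k).
   For w smooth this is tensorial in the phi_i. *)
Definition ext_conn (nabla : connection) (k : nat) (w : multiform_field k)
    (phi : 'I_k -> cosection) (x : M) (v : tangent x) : R :=
  v (fun y => w y (fun i => phi i y)) -
  \sum_(i < k) w x (fun j => if j == i then dual_conn nabla (phi i) v
                             else phi j x).

(* hat-nabla w = eta, for a 1-form eta with values in the exterior power *)
Definition ext_derivative (nabla : connection) (k : nat)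
    (w : multiform_field k)
    (eta : forall x : M, tangent x -> multiform (E x) k) : Prop :=
  forall (x : M) (v : tangent x) (phi : 'I_k -> cosection),
    (forall i, smooth_cosection_near (phi i) x) ->
    ext_conn nabla w phi v = eta x v (fun i => phi i x).

Definition ext_parallel (nabla : connection) (k : nat)
    (w : multiform_field k) : Prop :=
  ext_derivative nabla w (fun x v phi => 0).

Definition ext_recurrent (nabla : connection) (k : nat)
    (w : multiform_field k) (alpha : one_form M) : Prop :=
  ext_derivative nabla w (fun x v phi => alpha x v * w x phi).

(* h^*: the covectors are carried to E by the inverse of u |-> h(u, -). *)
Definition dual_metric (h : bilinear_field) (x : M) (phi psi : dual (E x)) : R :=
  h x ((h x)^-1%VF phi) ((h x)^-1%VF psi).

(* Theta_N(phi, psi) = h^*(phi, N^* psi) *)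
Definition Theta (h : bilinear_field) (N : endo_field) : multiform_field 2 :=
  fun x phi => dual_metric h (phi ord0) (phi ord_max \o N x)%VF.

Definition xi (n : nat) (h : bilinear_field) (N : endo_field)
    : multiform_field (n * 2) :=
  fun x phi => (-1) ^+ (n * n.-1)./2 / (n`!)%:R *
    wedge_power (Theta h N (x := x)) n phi.

End VectorBundle.

Arguments wedge_power [R V k] a p _.
Arguments xi [R m M r E] n h N [x] _.

(* 4n, bracketed so that matrices of this size split into n x n blocks and the
   first 2n indices (space-like) come from the left summand. *)
Notation rank4 n := ((n + n) + (n + n))%N.

Section NilpotentStructure.
Variables (R : realType) (m n : nat) (M : manifold R m).
Variable E : vbundle M (rank4 n).

Definition neutral_mx : 'M[R]_(rank4 n) :=
  block_mx (1%:M : 'M[R]_(n + n)) 0 0 (- 1%:M : 'M[R]_(n + n)).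

Definition pseudo_orthonormal (h : bilinear_field E) (x : M)
    (e : (rank4 n).-tuple (E x)) : Prop :=
  basis_of fullv e /\
  forall i j, h x (tnth e i) (tnth e j) = neutral_mx i j.

Definition neutral_metric (h : bilinear_field E) : Prop :=
  [/\ smooth_bilinear h,
      forall x (u v : E x), h x u v = h x v u
    & forall x, exists e : (rank4 n).-tuple (E x), pseudo_orthonormal h e].

(* The sign epsilon is + for [eps = false] and - for [eps = true]. *)
Definition I_sign (eps : bool) : 'M[R]_n :=
  diag_mx (\row_(j < n) if j == 0%N :> nat then (-1) ^+ eps else 1).

Definition I'_sign (eps : bool) : 'M[R]_(rank4 n) :=
  block_mx (1%:M : 'M[R]_(n + n)) 0
           0 (block_mx (1%:M : 'M[R]_n) 0 0 (I_sign eps)).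

Definition Lambda : 'M[R]_(rank4 n) :=
  let I : 'M[R]_n := 1%:M in
  let P : 'M[R]_(n + n) := block_mx 0 (- I) I 0 in
  let Q : 'M[R]_(n + n) := block_mx 0 I I 0 in
  block_mx P Q Q P.

(* e A, for the row vector e = (e_1, ..., e_r) *)
Definition tuple_mulmx (V : vectType R) (r : nat) (e : r.-tuple V)
    (A : 'M[R]_r) : r.-tuple V :=
  [tuple \sum_(i < r) A i j *: tnth e i | j < r].

Definition nilpotent_structure (o : orientation E) (h : bilinear_field E)
    (eps : bool) (N : endo_field E) : Prop :=
  smooth_endo N /\
  forall x : M, exists (U : set M) (e : forall y : M, (rank4 n).-tuple (E y)),
    [/\ open U, U x, frame_field U e &
        forall y, U y ->
          [/\ pseudo_orthonormal h (e y),
              positive o (e y) &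
              tuple_mulmx (map_tuple (N y) (e y)) (I'_sign eps) =
              tuple_mulmx (tuple_mulmx (e y) (I'_sign eps)) Lambda]].

End NilpotentStructure.

(* Main.v *)
From HB Require Import structures.
Require Import Defs.
From mathcomp Require Import all_boot all_order all_algebra all_fingroup.
From mathcomp Require Import all_classical all_reals all_analysis.
From mathcomp Require Import ring.

(** Around each point there are smooth sections [q_a], for [a < 2 n], spanning an
    isotropic complement of [Im N], such that [h(q_a, N q_b) = J_ab] with [J] the
    standard symplectic matrix ([nilpotent_frame_tuple]). Together with the
    [N q_a] they form a frame, from which one reads that [N] is skew for [h],
    that [Im N = Ker N], and that [N] satisfies the Walker condition if and only
    if [N (nabla_v (N q_b)) = 0] for all [b] and [v].

    For covectors [phi_a] let [P] be the matrix of the [phi_a (N q_b)]. The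
    matrix of the [Theta (phi_a, phi_b)] is [- P J P^T], and the [n]-th exterior
    power of a bivector is a Pfaffian ([wedge_power2E]). The identity
    [Pf (P A P^T) = \det P * Pf A] gives [xi (phi) = c * \det P] for a constant
    [c], which is nonzero because every term of the sum over permutations that
    defines the Pfaffian of [J] is 0 or 1 ([pfaffian_sum_symplectic_neq0]).
    Differentiating the determinant row by row, one gets [ext_conn_xi]:
    [(nabla_v xi)(phi)] is [c] times the sum over [i] of the determinant of [P]
    with its [i]-th row replaced by the [phi_i (nabla_v (N q_b))].

    (a) Under the Walker condition [nabla_v (N q_b)] is a combination of the
    [N q_a] with a matrix of coefficients [B], the replaced rows are those of
    [P B], and the sum of determinants is [\tr B * \det P]: thus [xi] is
    recurrent, with factor [\tr B]. This factor does not depend on the frame, as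
    [xi] vanishes nowhere, so that it defines a smooth 1-form. Conversely, take
    [phi_i = h(N w, -)] for one index [i] and [phi_a = h(q_a, -)] for the others.
    The row [i] of [P] is zero, hence [xi (phi) = 0], and recurrence says that a
    single determinant vanishes; letting [i] vary, [h(N w, nabla_v (N q_b)) = 0]
    for all [w], that is, [N (nabla_v (N q_b)) = 0].

    (b) Every smooth covector field is [h(s, -)] for a smooth [s], and
    [Theta (h(s, -), h(t, -)) = - h(s, N t)]. As [nabla h = 0], the covariant
    derivative of [Theta] is [- h(s, (nabla_v N) t)], which vanishes for all [s]
    and [t] if and only if [nabla_v N = 0]. If [N] is parallel then
    [N (nabla_v (N q_b)) = N (N (nabla_v q_b)) = 0], which is the Walker
    condition, and the matrix of the [h(q_a, nabla_v (N q_b))] is symmetric, so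
    that its contraction with [J], which is [- \tr B], vanishes and [xi] is
    parallel. *)

Set Implicit Arguments.
Unset Strict Implicit.
Unset Printing Implicit Defensive.

Import Order.TTheory GRing.Theory Num.Theory.
Import numFieldNormedType.Exports.

Local Open Scope classical_set_scope.
Local Open Scope ring_scope.

(** * Differentiability of class C^k on subsets of R^m *)

Lemma near_eq_differentiable (R : numFieldType) (V W : normedModType R)
    (f g : V -> W) (x : V) :
  {near x, f =1 g} -> differentiable f x -> differentiable g x.
Proof.
move=> fg /[dup] df /diff_locallyP[dfc dfE].
have gE : g \o shift x = cst (g x) + 'd f x +o_ 0 id.
  move: dfE => /eqaddoP dfE; apply/eqaddoP => e e0.
  have fg0 : \forall y \near (0 : V), f (y + x) = g (y + x).
    by move: fg; rewrite (near_shift 0); apply: filterS => y /=; rewrite subr0.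
  near=> y.
  have <- : (f \o shift x - (cst (f x) + 'd f x)) y =
            (g \o shift x - (cst (g x) + 'd f x)) y.
    rewrite !fctE /= /cst (nbhs_singleton fg).
    by congr (_ - _); near: y.
  by near: y; exact: dfE.
by apply/diff_locallyP; rewrite (diff_unique dfc gE).
Unshelve. all: by end_near. Qed.

Section EuclideanSmoothness.
Context {R : realType} {m : nat}.
Implicit Types (U : set 'rV[R]_m) (f g : 'rV[R]_m -> R).

(** The derivatives in [Ck k U f] are taken in the whole space, so that
    [Ck k U f] is a condition on the germ of [f] at each point of [U]. *)
Lemma Ck_bigcup (k : nat) U f :
  Ck k U f <-> forall x, U x -> Ck k [set x] f.
Proof.
elim: k f => [|k IHk] f /=.
  by split=> [Uf x Ux _ ->|Uf x Ux]; [exact: Uf|exact: (Uf x Ux)].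
split=> [[df Df] x Ux|Uf].
  split=> [_ ->|v]; first exact: df.
  by have /IHk := Df v; apply.
split=> [x Ux|v]; first by have [+ _] := Uf x Ux; apply.
by apply/IHk => x Ux; have [_] := Uf x Ux; apply.
Qed.

Lemma Ck_sub (k : nat) U V f : V `<=` U -> Ck k U f -> Ck k V f.
Proof. by move=> VU /Ck_bigcup Uf; apply/Ck_bigcup => x /VU; exact: Uf. Qed.

Lemma near_eq_Ck (k : nat) (x : 'rV[R]_m) f g :
  {near x, f =1 g} -> Ck k [set x] f -> Ck k [set x] g.
Proof.
elim: k f g => [|k IHk] f g fg /=.
  move=> /(_ x erefl) fx _ ->; rewrite /prop_for /continuous_at.
  rewrite -(nbhs_singleton fg); apply: cvg_trans fx.
  exact: (@near_eq_cvg _ _ (nbhs x) _ f g fg).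
move=> [df Df]; split=> [_ ->|v].
  by apply: near_eq_differentiable fg _; exact: df.
apply: IHk (Df v).
have := nbhs_interior fg; apply: filterS => y; exact: near_eq_derive.
Qed.

Lemma eq_Ck (k : nat) U f g :
  open U -> (forall x, U x -> f x = g x) -> Ck k U f -> Ck k U g.
Proof.
move=> Uo fg /Ck_bigcup Uf; apply/Ck_bigcup => x Ux.
apply: near_eq_Ck (Uf x Ux); apply: filterS fg _.
exact: open_nbhs_nbhs.
Qed.

Lemma Ck_ltW (k : nat) U f : Ck k.+1 U f -> Ck k U f.
Proof.
elim: k f => [|k IHk] f [df Df].
  by move=> x Ux; apply: differentiable_continuous; exact: df.
by split=> // v; exact: IHk.
Qed.

Lemma Ck_cst (k : nat) U (a : R) : Ck k U (fun=> a).
Proof.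
elim: k a => [|k IHk] a /=; first by move=> x _; exact: cst_continuous.
split=> [x _|v]; first exact: differentiable_cst.
have -> : (fun x => 'D_v (fun=> a) x) = fun=> 0.
  by apply/funext => x; exact: derive_cst.
exact: IHk.
Qed.

Lemma CkD (k : nat) U f g : open U ->
  Ck k U f -> Ck k U g -> Ck k U (fun x => f x + g x).
Proof.
move=> Uo; elim: k f g => [|k IHk] f g /=.
  by move=> cf cg x Ux; apply: continuousD; [exact: cf|exact: cg].
move=> [df Df] [dg Dg]; split=> [x Ux|v].
  by apply: differentiableD; [exact: df|exact: dg].
apply: (eq_Ck Uo) (IHk _ _ (Df v) (Dg v)) => x Ux.
by rewrite -deriveD//; apply: diff_derivable; [exact: df|exact: dg].
Qed.

Lemma CkM (k : nat) U f g : open U ->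
  Ck k U f -> Ck k U g -> Ck k U (fun x => f x * g x).
Proof.
move=> Uo; elim: k f g => [|k IHk] f g.
  by move=> cf cg x Ux; apply: continuousM; [exact: cf|exact: cg].
move=> /[dup] /Ck_ltW cf [df Df] /[dup] /Ck_ltW cg [dg Dg].
split=> [x Ux|v].
  by apply: differentiableM; [exact: df|exact: dg].
apply: (eq_Ck Uo) (CkD Uo (IHk _ _ cf (Dg v)) (IHk _ _ cg (Df v))) => x Ux.
by rewrite -[RHS]/('D_v (f * g) x) deriveM//;
  apply: diff_derivable; [exact: df|exact: dg].
Qed.

End EuclideanSmoothness.

(** * Smooth functions and derivations on a manifold *)

Section ManifoldSmoothness.
Context {R : realType} {m : nat} {M : manifold R m}.
Implicit Types (U V : set M) (f g : M -> R) (x : M).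

Lemma chart_image_open (c : chart R M m) U :
  open U -> open (cmap c @` (cdom c `&` U)).
Proof.
move=> Uo; rewrite openE => _ [x [cx Ux] <-].
have imx : (cmap c @` cdom c) (cmap c x) by exists x.
have nU : nbhs (cinv c (cmap c x)) (cdom c `&` U).
  rewrite cmapK//; apply: open_nbhs_nbhs; split=> //.
  exact: openI (@cdom_open _ _ _ c) Uo.
have nI : nbhs (cmap c x) (cmap c @` cdom c).
  by apply: open_nbhs_nbhs; split=> //; exact: cimg_open.
have nP := cinv_continuous imx nU.
apply: filterS (filterI nI nP) => _ [[z cz <-]] /= [].
by rewrite cmapK// => _ Uz; exists z.
Qed.

(** Smoothness on a set is a condition at each of its points, on germs. *)
Lemma smooth_on_bigcup U f :
  smooth_on U f <-> forall x, U x -> smooth_on [set x] f.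
Proof.
split=> [Uf x Ux c ac k|Uf c ac k].
  apply: Ck_sub (Uf c ac k) => _ [y [cy yx] <-]; exists y => //.
  by split=> //; rewrite yx.
apply/Ck_bigcup => _ [x [cx Ux] <-]; apply: Ck_sub (Uf x Ux c ac k).
by move=> _ ->; exists x.
Qed.

Lemma smooth_on_sub U V f : V `<=` U -> smooth_on U f -> smooth_on V f.
Proof.
move=> VU /smooth_on_bigcup Uf; apply/smooth_on_bigcup => x /VU; exact: Uf.
Qed.

Lemma near_eq_smooth_on x f g :
  {near x, f =1 g} -> smooth_on [set x] f -> smooth_on [set x] g.
Proof.
move=> fg xf c ac k; apply/Ck_bigcup => _ [y [+ yx] <-]; rewrite {}yx => cx.
apply: (@near_eq_Ck _ _ _ _ (f \o cinv c)).
  have imx : (cmap c @` cdom c) (cmap c x) by exists x.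
  have fg' : nbhs (cinv c (cmap c x)) (fun z => f z = g z) by rewrite cmapK.
  exact: cinv_continuous imx _ fg'.
by apply: Ck_sub (xf c ac k) => _ ->; exists x.
Qed.

Lemma smooth_on_local U f :
  (forall x, U x -> exists V g, [/\ V x, smooth_on V g & {near x, g =1 f}]) ->
  smooth_on U f.
Proof.
move=> Uf; apply/smooth_on_bigcup => x Ux.
have [V [g [Vx Vg gf]]] := Uf x Ux.
by apply: near_eq_smooth_on gf _; apply: smooth_on_sub Vg => _ ->.
Qed.

Lemma eq_smooth_on U f g :
  open U -> (forall x, U x -> f x = g x) -> smooth_on U f -> smooth_on U g.
Proof.
move=> Uo fg Uf; apply: smooth_on_local => x Ux; exists U, f; split=> //.
by apply: filterS fg _; exact: open_nbhs_nbhs.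
Qed.

Lemma smooth_on_cst U (a : R) : smooth_on U (fun=> a).
Proof. by move=> c _ k; exact: Ck_cst. Qed.

Lemma smooth_onD U f g : open U ->
  smooth_on U f -> smooth_on U g -> smooth_on U (fun x => f x + g x).
Proof.
by move=> Uo Uf Ug c ac k; apply: CkD;
  [exact: chart_image_open|exact: Uf|exact: Ug].
Qed.

Lemma smooth_onM U f g : open U ->
  smooth_on U f -> smooth_on U g -> smooth_on U (fun x => f x * g x).
Proof.
by move=> Uo Uf Ug c ac k; apply: CkM;
  [exact: chart_image_open|exact: Uf|exact: Ug].
Qed.

Lemma smooth_on_sum U (I : Type) (r : seq I) (F : I -> M -> R) : open U ->
  (forall i, smooth_on U (F i)) -> smooth_on U (fun x => \sum_(i <- r) F i x).
Proof.
move=> Uo UF; elim: r => [|i r IHr].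
  by under eq_fun do rewrite big_nil; exact: smooth_on_cst.
by under eq_fun do rewrite big_cons; exact: smooth_onD.
Qed.

Lemma smooth_near_cst (a : R) x : smooth_near (fun _ : M => a) x.
Proof. by exists setT; split=> //; [exact: openT|exact: smooth_on_cst]. Qed.

Lemma smooth_near2 (P : (M -> R) -> (M -> R) -> M -> R) f g x :
  (forall U, open U -> smooth_on U f -> smooth_on U g -> smooth_on U (P f g)) ->
  smooth_near f x -> smooth_near g x -> smooth_near (P f g) x.
Proof.
move=> UP [U [Uo Ux Uf]] [V [Vo Vx Vg]]; exists (U `&` V).
have UVo := openI Uo Vo; split=> //.
by apply: UP => //; [exact: smooth_on_sub Uf|exact: smooth_on_sub Vg].
Qed.

Lemma smooth_nearD f g x : smooth_near f x -> smooth_near g x ->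
  smooth_near (fun y => f y + g y) x.
Proof.
by apply: (smooth_near2 (P := fun f g y => f y + g y)) => U; exact: smooth_onD.
Qed.

Lemma smooth_nearM f g x : smooth_near f x -> smooth_near g x ->
  smooth_near (fun y => f y * g y) x.
Proof.
by apply: (smooth_near2 (P := fun f g y => f y * g y)) => U; exact: smooth_onM.
Qed.

Lemma smooth_near_sum (I : Type) (r : seq I) (F : I -> M -> R) x :
  (forall i, smooth_near (F i) x) ->
  smooth_near (fun y => \sum_(i <- r) F i y) x.
Proof.
move=> FF; elim: r => [|i r IHr].
  by under eq_fun do rewrite big_nil; exact: smooth_near_cst.
by under eq_fun do rewrite big_cons; exact: smooth_nearD.
Qed.

Lemma smooth_near_prod (I : Type) (r : seq I) (F : I -> M -> R) x :
  (forall i, smooth_near (F i) x) ->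
  smooth_near (fun y => \prod_(i <- r) F i y) x.
Proof.
move=> FF; elim: r => [|i r IHr].
  by under eq_fun do rewrite big_nil; exact: smooth_near_cst.
by under eq_fun do rewrite big_cons; exact: smooth_nearM.
Qed.

Section Derivation.
Context {x : M} (v : tangent x).

Lemma tangent0 : v (fun=> 0) = 0.
Proof.
have := tact_linear v 1 (smooth_near_cst 0 x) (smooth_near_cst 0 x).
under eq_fun do rewrite mulr0 addr0.
by rewrite mul1r => /esym/eqP; rewrite -subr_eq0 addrK => /eqP.
Qed.

Lemma tangent_cst (a : R) : v (fun=> a) = 0.
Proof.
have v1 : v (fun=> 1) = 0.
  have := tact_leibniz v (smooth_near_cst 1 x) (smooth_near_cst 1 x).
  under eq_fun do rewrite mulr1.
  by rewrite mul1r => /esym/eqP; rewrite -subr_eq0 addrK => /eqP.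
have := tact_linear v a (smooth_near_cst 1 x) (smooth_near_cst 0 x).
by under eq_fun do rewrite mulr1 addr0; rewrite v1 tangent0 mulr0 addr0.
Qed.

Lemma tangentD f g : smooth_near f x -> smooth_near g x ->
  v (fun y => f y + g y) = v f + v g.
Proof.
move=> xf xg; have := tact_linear v 1 xf xg.
by under eq_fun do rewrite mul1r; rewrite mul1r.
Qed.

Lemma tangentZ (a : R) f : smooth_near f x -> v (fun y => a * f y) = a * v f.
Proof.
move=> xf; have := tact_linear v a xf (smooth_near_cst 0 x).
by under eq_fun do rewrite addr0; rewrite tangent0 addr0.
Qed.

Lemma tangent_sum (I : Type) (r : seq I) (F : I -> M -> R) :
  (forall i, smooth_near (F i) x) ->
  v (fun y => \sum_(i <- r) F i y) = \sum_(i <- r) v (F i).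
Proof.
move=> FF; elim: r => [|i r IHr].
  by under eq_fun do rewrite big_nil; rewrite big_nil tangent0.
under eq_fun do rewrite big_cons; rewrite big_cons -IHr tangentD//.
exact: smooth_near_sum.
Qed.

Lemma tangent_prod (I : eqType) (r : seq I) (F : I -> M -> R) : uniq r ->
  (forall i, smooth_near (F i) x) ->
  v (fun y => \prod_(i <- r) F i y) =
  \sum_(i <- r) \prod_(j <- r) (if j == i then v (F i) else F j x).
Proof.
move=> + FF; elim: r => [_|i r IHr /= /andP[ir ur]].
  by under eq_fun do rewrite big_nil; rewrite big_nil tangent_cst.
under eq_fun do rewrite big_cons.
rewrite tact_leibniz//; last exact: smooth_near_prod.
rewrite big_cons IHr// mulr_sumr addrC; congr (_ + _).
  rewrite big_cons eqxx mulrC; congr (_ * _); apply: eq_big_seq => j jr.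
  by case: eqP jr ir => // -> ->.
apply: eq_big_seq => j jr; rewrite big_cons.
by case: eqP jr ir => // -> ->.
Qed.

(** Derivative of a determinant, row by row. *)
Lemma tangent_det (k : nat) (A : 'I_k -> 'I_k -> M -> R) :
  (forall i j, smooth_near (A i j) x) ->
  v (fun y => \det (\matrix_(i, j) A i j y)) =
  \sum_i \det (\matrix_(a, b) if a == i then v (A a b) else A a b x).
Proof.
move=> AA; rewrite (_ : (fun y => _) = fun y =>
    \sum_(s : 'S_k) (-1) ^+ s * \prod_i A i (s i) y); last first.
  apply/funext => y; apply: eq_bigr => s _; congr (_ * _).
  by apply: eq_bigr => i _; rewrite mxE.
transitivity (\sum_i \sum_(s : 'S_k) (-1) ^+ s *
    \prod_a (if a == i then v (A a (s a)) else A a (s a) x)); last first.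
  apply: eq_bigr => i _; apply: eq_bigr => s _; congr (_ * _).
  by apply: eq_bigr => a _; rewrite mxE.
rewrite exchange_big tangent_sum; last first.
  move=> s; apply: smooth_nearM; first exact: smooth_near_cst.
  exact: smooth_near_prod.
apply: eq_bigr => s _; rewrite tangentZ; last exact: smooth_near_prod.
rewrite -mulr_sumr tangent_prod ?index_enum_uniq//; congr (_ * _).
by apply: eq_bigr => i _; apply: eq_bigr => j _; case: eqP => [->|].
Qed.

End Derivation.
End ManifoldSmoothness.

(** * Pfaffian sums *)

Lemma double_ord_subproof p (k : 'I_p) (b : 'I_2) : (k * 2 + b < p * 2)%N.
Proof.
by apply: (@leq_trans (k.+1 * 2)); rewrite ?leq_mul2r//= mulSn addnC ltn_add2r.
Qed.

(** The indices [0 <= a < p * 2] are the [k * 2 + b], with [k < p] and [b < 2]: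
    they come in [p] consecutive pairs [even_ord k], [odd_ord k]. *)
Definition double_ord p (k : 'I_p) (b : 'I_2) : 'I_(p * 2) :=
  Ordinal (double_ord_subproof k b).

Definition even_ord p (k : 'I_p) := double_ord k ord0.
Definition odd_ord p (k : 'I_p) := double_ord k ord_max.

Lemma half_ord_subproof p (a : 'I_(p * 2)) : (a./2 < p)%N.
Proof. by rewrite -divn2 ltn_divLR. Qed.

(** The pair to which an index belongs. *)
Definition half_ord p (a : 'I_(p * 2)) : 'I_p := Ordinal (half_ord_subproof a).

Lemma half_double_ord p (k : 'I_p) b : half_ord (double_ord k b) = k.
Proof.
apply: val_inj; rewrite /= muln2 halfD odd_double half_double /=.
by case: b => [[|[|]]] //= _; rewrite addn0.
Qed.

Lemma half_even_ord p (k : 'I_p) : half_ord (even_ord k) = k.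
Proof. exact: half_double_ord. Qed.

Lemma half_odd_ord p (k : 'I_p) : half_ord (odd_ord k) = k.
Proof. exact: half_double_ord. Qed.

Lemma odd_even_ord p (k : 'I_p) : odd (even_ord k) = false.
Proof. by rewrite /= muln2 addn0 odd_double. Qed.

Lemma odd_odd_ord p (k : 'I_p) : odd (odd_ord k).
Proof. by rewrite /= muln2 addn1 /= odd_double. Qed.

Lemma half_ordK p (a : 'I_(p * 2)) :
  a = if odd a then odd_ord (half_ord a) else even_ord (half_ord a).
Proof.
apply: val_inj; rewrite -[LHS]odd_double_half addnC -muln2.
by case: (odd a).
Qed.

Lemma double_ord_ind p (P : 'I_(p * 2) -> Prop) :
  (forall k, P (even_ord k)) -> (forall k, P (odd_ord k)) -> forall a, P a.
Proof. by move=> P0 P1 a; rewrite [a]half_ordK; case: ifP. Qed.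

Lemma even_odd_neq p (k l : 'I_p) : (even_ord k == odd_ord l) = false.
Proof.
apply/eqP => /(congr1 (odd \o val)) /=.
by rewrite !muln2 oddD !odd_double addn1 /= odd_double.
Qed.

Section PairBigops.
Variables (T : Type) (idx : T) (op : Monoid.com_law idx).

Lemma big_pair_ord p (F : 'I_(p * 2) -> T) :
  \big[op/idx]_a F a = \big[op/idx]_(k < p) op (F (even_ord k)) (F (odd_ord k)).
Proof.
rewrite (bigID (fun a : 'I_(p * 2) => odd a)) /= Monoid.mulmC big_split /=.
congr (op _ _).
  rewrite (reindex_onto (@even_ord p) (@half_ord p)) /=; last first.
    by move=> a /negPf oa; rewrite [RHS]half_ordK oa.
  apply: eq_bigl => k; rewrite half_even_ord eqxx andbT.
  by have := odd_even_ord k => /= ->.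
rewrite (reindex_onto (@odd_ord p) (@half_ord p)) /=; last first.
  by move=> a oa; rewrite [RHS]half_ordK oa.
apply: eq_bigl => k; rewrite half_odd_ord eqxx andbT.
by have := odd_odd_ord k => /= ->.
Qed.

End PairBigops.

Section PfaffianSum.
Variable R : comPzRingType.

(** The Pfaffian of [A], up to a factor [2 ^ p * p!]. *)
Definition pfaffian_sum p (A : 'M[R]_(p * 2)) : R :=
  \sum_(s : 'S_(p * 2)) (-1) ^+ s *
    \prod_(k < p) A (s (even_ord k)) (s (odd_ord k)).

(** Expanding the product over [k] of the entries of [B A B^T] gives a sum over
    the choices [f k] of a pair of columns of [B] for each [k], weighted by the
    determinants of the chosen columns. *)
Lemma pfaffian_sum_congr_expand p (B A : 'M[R]_(p * 2)) :
  pfaffian_sum (B *m A *m B^T) =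
  \sum_(f : {ffun 'I_p -> 'I_(p * 2) * 'I_(p * 2)})
    (\prod_k A (f k).1 (f k).2) *
    \det (rowsub (fun a => if odd a then (f (half_ord a)).2
                           else (f (half_ord a)).1) B^T).
Proof.
transitivity (\sum_(s : 'S_(p * 2))
    \sum_(f : {ffun 'I_p -> 'I_(p * 2) * 'I_(p * 2)})
    (\prod_k A (f k).1 (f k).2) * ((-1) ^+ s *
    \prod_k (B (s (even_ord k)) (f k).1 * B (s (odd_ord k)) (f k).2))).
  apply: eq_bigr => s _.
  transitivity ((-1) ^+ s * \prod_k \sum_(cd : 'I_(p * 2) * 'I_(p * 2))
    (A cd.1 cd.2 * (B (s (even_ord k)) cd.1 * B (s (odd_ord k)) cd.2))).
    congr (_ * _); apply: eq_bigr => k _; rewrite mxE.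
    rewrite -(pair_big predT predT (fun c d =>
       A c d * (B (s (even_ord k)) c * B (s (odd_ord k)) d))) exchange_big /=.
    apply: eq_bigr => d _; rewrite !mxE mulr_suml; apply: eq_bigr => c _.
    by rewrite mulrCA mulrA.
  rewrite bigA_distr_bigA mulr_sumr; apply: eq_bigr => f _.
  by rewrite big_split /= mulrCA.
rewrite exchange_big; apply: eq_bigr => f _; rewrite -mulr_sumr.
congr (_ * _); apply: eq_bigr => s _; congr (_ * _).
rewrite big_pair_ord; apply: eq_bigr => k _.
by rewrite !mxE half_even_ord half_odd_ord odd_odd_ord odd_even_ord.
Qed.

Lemma pfaffian_sum_congr p (B A : 'M[R]_(p * 2)) :
  pfaffian_sum (B *m A *m B^T) = \det B * pfaffian_sum A.
Proof.
(* The columns chosen in [B] are the product of [B] with those chosen in the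
   identity matrix, so each determinant is [\det B] times the one for [1]. *)
have -> : pfaffian_sum A = pfaffian_sum (1%:M *m A *m (1%:M)^T).
  by rewrite trmx1 mul1mx mulmx1.
rewrite !pfaffian_sum_congr_expand mulr_sumr; apply: eq_bigr => f _.
rewrite mulrCA; congr (_ * _); rewrite -[B^T]mul1mx -mul_rowsub_mx.
by rewrite det_mulmx det_tr mulrC trmx1.
Qed.

Lemma pfaffian_sumN p (A : 'M[R]_(p * 2)) :
  pfaffian_sum (- A) = (-1) ^+ p * pfaffian_sum A.
Proof.
rewrite mulr_sumr; apply: eq_bigr => s _; rewrite mulrCA; congr (_ * _).
by under eq_bigr do rewrite mxE; rewrite prodrN card_ord.
Qed.

(** The standard symplectic matrix, with blocks [[0, 1], [-1, 0]] on the
    consecutive pairs of indices. *)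
Definition symplectic_mx p : 'M[R]_(p * 2) :=
  \matrix_(a, b) ((half_ord a == half_ord b)%:R * ((odd b)%:R - (odd a)%:R)).

Lemma eq_odd_ord p (k : 'I_p) (a : 'I_(p * 2)) :
  (a == odd_ord k) = (k == half_ord a) && odd a.
Proof.
apply/eqP/andP => [->|[/eqP-> oa]]; first by rewrite half_odd_ord odd_odd_ord.
by rewrite {1}[a]half_ordK oa.
Qed.

Lemma eq_even_ord p (k : 'I_p) (a : 'I_(p * 2)) :
  (a == even_ord k) = (k == half_ord a) && ~~ odd a.
Proof.
apply/eqP/andP => [->|[/eqP-> oa]]; first by rewrite half_even_ord odd_even_ord.
by rewrite {1}[a]half_ordK (negPf oa).
Qed.

Lemma symplectic_even p (k : 'I_p) (a : 'I_(p * 2)) :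
  symplectic_mx p (even_ord k) a = (a == odd_ord k)%:R.
Proof.
by rewrite mxE half_even_ord odd_even_ord subr0 -natrM mulnb eq_odd_ord.
Qed.

Lemma symplectic_odd p (k : 'I_p) (a : 'I_(p * 2)) :
  symplectic_mx p (odd_ord k) a = - (a == even_ord k)%:R.
Proof.
rewrite mxE half_odd_ord odd_odd_ord eq_even_ord.
by case: eqP => _ /=; case: (odd a);
  rewrite ?(subrr, sub0r, mulr1, mul1r, mul0r, oppr0).
Qed.

Lemma tr_symplectic_mx p : (symplectic_mx p)^T = - symplectic_mx p.
Proof.
by apply/matrixP => a b; rewrite !mxE eq_sym -mulrN opprB.
Qed.

Lemma symplectic_mxC p (a b : 'I_(p * 2)) :
  symplectic_mx p a b = - symplectic_mx p b a.
Proof.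
by have /matrixP/(_ b a) := tr_symplectic_mx p; rewrite mxE [RHS]mxE.
Qed.

Lemma mul_symplectic_mx p : symplectic_mx p *m symplectic_mx p = - 1%:M.
Proof.
apply/matrixP => a b; rewrite mxE [RHS]mxE mxE.
elim/double_ord_ind: a => k.
  rewrite (bigD1 (odd_ord k)) //= symplectic_even eqxx mul1r symplectic_odd.
  rewrite big1 ?addr0 1?eq_sym// => c /negPf ck.
  by rewrite symplectic_even ck mul0r.
rewrite (bigD1 (even_ord k)) //= symplectic_odd eqxx mulN1r symplectic_even.
rewrite big1 ?addr0 1?eq_sym// => c /negPf ck.
by rewrite symplectic_odd ck oppr0 mul0r.
Qed.

End PfaffianSum.

Lemma even_ord_inj p : injective (@even_ord p).
Proof. by move=> k l /(congr1 (@half_ord p)); rewrite !half_even_ord. Qed.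

Lemma odd_ord_inj p : injective (@odd_ord p).
Proof. by move=> k l /(congr1 (@half_ord p)); rewrite !half_odd_ord. Qed.

Lemma even_ord_eq p (k l : 'I_p) : (even_ord k == even_ord l) = (k == l).
Proof. exact: inj_eq (@even_ord_inj p) _ _. Qed.

Lemma odd_ord_eq p (k l : 'I_p) : (odd_ord k == odd_ord l) = (k == l).
Proof. exact: inj_eq (@odd_ord_inj p) _ _. Qed.

Lemma odd_even_neq p (k l : 'I_p) : (odd_ord k == even_ord l) = false.
Proof. by rewrite eq_sym even_odd_neq. Qed.

Section PfaffianSymplectic.
Variables (R : numDomainType) (p : nat).
Implicit Type s : 'S_(p * 2).

(** The term of [s] in the Pfaffian sum of the symplectic matrix. *)
Let term s : R := (-1) ^+ s *
  \prod_(k < p) symplectic_mx R p (s (even_ord k)) (s (odd_ord k)).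

Let term_flip (l : 'I_p) s :
  term (tperm (even_ord l) (odd_ord l) * s)%g = term s.
Proof.
rewrite /term odd_permM odd_tperm even_odd_neq addTb signrN mulNr -mulrN.
congr (_ * _); rewrite (bigD1 l) //= [in RHS](bigD1 l) //= !permM.
rewrite tpermL tpermR symplectic_mxC mulNr opprK; congr (_ * _).
apply: eq_bigr => k /negPf kl; rewrite !permM !tpermD//;
by rewrite ?even_odd_neq ?odd_even_neq ?odd_ord_eq ?even_ord_eq 1?eq_sym ?kl.
Qed.

(** The exchange of the pairs of indices [k] and [l]. *)
Let swap (k l : 'I_p) : 'S_(p * 2) :=
  (tperm (even_ord k) (even_ord l) * tperm (odd_ord k) (odd_ord l))%g.

Let swap_even k l j : swap k l (even_ord j) = even_ord (tperm k l j).
Proof.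
rewrite permM -(inj_tperm _ _ _ (@even_ord_inj p)).
by rewrite [LHS]tpermD ?odd_even_neq.
Qed.

Let swap_odd k l j : swap k l (odd_ord j) = odd_ord (tperm k l j).
Proof.
rewrite permM (_ : tperm (even_ord k) _ _ = odd_ord j); last first.
  by rewrite tpermD ?even_odd_neq.
by rewrite -(inj_tperm _ _ _ (@odd_ord_inj p)).
Qed.

Let term_swap (k l : 'I_p) s : term (swap k l * s)%g = term s.
Proof.
rewrite /term odd_permM odd_permM !odd_tperm.
rewrite odd_ord_eq even_ord_eq addbb addFb.
congr (_ * _); rewrite [RHS](reindex_inj (@perm_inj _ (tperm k l))) /=.
by apply: eq_bigr => j _; rewrite !(permM (swap k l)) swap_even swap_odd.
Qed.

(** [s] fixes the indices of the first [k] pairs. *)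
Let fixes s (k : nat) := forall j : 'I_p, (j < k)%N ->
  s (even_ord j) = even_ord j /\ s (odd_ord j) = odd_ord j.

(** Moving the preimage of [even_ord k] to [even_ord k] by exchanging the two
   members of a pair, then two pairs, does not change the term; that it is
   nonzero then forces [odd_ord k] to be fixed. *)
Let term_fix_next s (k : 'I_p) : fixes s k -> term s != 0 ->
  exists2 t, fixes t k.+1 & term t = term s.
Proof.
move=> sk s0; pose a := (s^-1%g (even_ord k)).
have sa : s a = even_ord k by rewrite permKV.
pose l := half_ord a.
have kl : (k <= l)%N.
  rewrite leqNgt; apply/negP => /[dup] lk /sk[s_ev s_od].
  suff lE : l = k by rewrite lE ltnn in lk.
  move: sa; rewrite [a]half_ordK -/l; case: ifP => _; rewrite ?s_ev ?s_od;
  by move=> /(congr1 (@half_ord p)); rewrite ?half_even_ord ?half_odd_ord.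
have [t [tk tl tE]] : exists t,
    [/\ fixes t k, t (even_ord l) = even_ord k & term t = term s].
  case oa : (odd a); last first.
    by exists s; split=> //; rewrite -sa [in RHS](half_ordK a) oa.
  exists (tperm (even_ord l) (odd_ord l) * s)%g; rewrite term_flip; split=> //.
    move=> j jk; have jl : (l == j) = false.
      by apply/eqP => lj; rewrite lj leqNgt jk in kl.
    rewrite !permM.
    rewrite !tpermD ?even_odd_neq ?odd_even_neq ?odd_ord_eq ?even_ord_eq ?jl//.
    exact: sk.
  by rewrite permM tpermL -sa [in RHS](half_ordK a) oa.
exists (swap k l * t)%g; last by rewrite term_swap.
have uk : fixes (swap k l * t)%g k.
  move=> j jk; rewrite !(permM (swap k l)) swap_even swap_odd.
  rewrite tpermD//; first exact: tk.
    by apply: contraTneq jk => ->; rewrite ltnn.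
  by apply: contraTneq jk => <-; rewrite ltnNge kl.
have uke : (swap k l * t)%g (even_ord k) = even_ord k.
  by rewrite (permM (swap k l)) swap_even tpermL.
move=> j; rewrite ltnS leq_eqVlt => /orP[/eqP/val_inj->|]; last exact: uk.
split=> //; move: s0; rewrite -tE -(term_swap k l) /term (bigD1 k) //= uke.
rewrite symplectic_even; case: (_ =P odd_ord k) => // _.
by rewrite !(mulr0n, mul0r, mulr0) eqxx.
Qed.

Let term_01 s : term s = 0 \/ term s = 1.
Proof.
have [->|s0] := eqVneq (term s) 0; [by left|right].
have H k : (k <= p)%N -> exists2 t, fixes t k & term t = term s.
  elim: k => [_|k IHk kp]; first by exists s.
  have [t tk ts] := IHk (ltnW kp).
  have t0 : term t != 0 by rewrite ts.
  have [u uk ut] := @term_fix_next t (Ordinal kp) tk t0.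
  by exists u => //; rewrite ut.
have [t tp <-] := H p (leqnn p).
have -> : t = 1%g.
  apply/permP => a; rewrite perm1.
  by elim/double_ord_ind: a => k; have [] := tp k (ltn_ord k).
rewrite /term odd_perm1 mul1r big1// => k _.
by rewrite !perm1 symplectic_even eqxx.
Qed.

(** Every term of the sum is 0 or 1, and the identity contributes 1. *)
Lemma pfaffian_sum_symplectic_neq0 : pfaffian_sum (symplectic_mx R p) != 0.
Proof.
apply: lt0r_neq0; rewrite /pfaffian_sum (bigD1 1%g) //=.
apply: ltr_wpDr.
  by apply: sumr_ge0 => s _; have [] := term_01 s; rewrite /term => ->.
rewrite odd_perm1 mul1r big1// => k _.
by rewrite !perm1 symplectic_even eqxx.
Qed.

End PfaffianSymplectic.

(** * Exterior powers of a bivector *)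

Section WedgePower.
Variables (R : realType) (V : vectType R).

(** The permutation [t] of the last [q] of [q + 2] indices. *)
Let lift2 q (t : 'S_q) : 'S_(q.+2) :=
  lift_perm ord0 ord0 (lift_perm ord0 ord0 t).

Let lift2_lshift q (t : 'S_q) (i : 'I_2) : lift2 t (lshift q i) = lshift q i.
Proof.
case: i => [[|[|//]]] i2.
  have -> : lshift q (Ordinal i2) = @ord0 q.+1 by exact: val_inj.
  exact: lift_perm_id.
have -> : lshift q (Ordinal i2) = @lift q.+2 ord0 (@ord0 q) by exact: val_inj.
by rewrite lift_perm_lift lift_perm_id.
Qed.

Let lift2_rshift q (t : 'S_q) (i : 'I_q) :
  lift2 t (rshift 2 i) = rshift 2 (t i).
Proof.
have -> : rshift 2 i = @lift q.+2 ord0 (@lift q.+1 ord0 i) by exact: val_inj.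
by rewrite !lift_perm_lift; apply: val_inj.
Qed.

Let odd_lift2 q (t : 'S_q) : lift2 t = t :> bool.
Proof. by rewrite !odd_lift_perm. Qed.

(** In the nested sums defining the wedge power, the permutations of the last
    indices are absorbed by the outer one. *)
Lemma wedge_power2E (a : multiform V 2) p (phi : 'I_(p * 2) -> dual V) :
  wedge_power a p phi = 2 ^- p * \sum_(s : 'S_(p * 2)) (-1) ^+ s *
    \prod_(k < p) a (fun i => phi (s (double_ord k i))).
Proof.
elim: p phi => [|p IHp] phi.
  rewrite (big_pred1 1%g) => [|s]; last first.
    by apply/esym/eqP/permP => -[].
  by rewrite big_ord0 odd_perm1 expr0 invr1 !mulr1.
pose G (s : 'S_(2 + p * 2)) := (-1) ^+ s *
  \prod_(k < p.+1) a (fun i => phi (s (double_ord k i))).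
have GE (t : 'S_(p * 2)) s : G (lift2 t * s)%g =
    (-1) ^+ s * a (fun i => phi (s (lshift (p * 2) i))) *
    ((-1) ^+ t *
     \prod_(k < p) a (fun i => phi (s (rshift 2 (t (double_ord k i)))))).
  rewrite /G odd_permM odd_lift2 signr_addb big_ord_recl.
  rewrite [RHS]mulrACA [(-1) ^+ s * (-1) ^+ t]mulrC; congr (_ * (_ * _)).
    congr a; apply/funext => i; congr phi; rewrite permM; congr (s _).
    have -> : @double_ord p.+1 ord0 i = lshift (p * 2) i by exact: val_inj.
    by rewrite lift2_lshift.
  apply: eq_bigr => k _; congr a; apply/funext => i; congr phi.
  rewrite permM; congr (s _).
  have -> : @double_ord p.+1 (lift ord0 k) i = rshift 2 (double_ord k i).
    exact: val_inj.
  by rewrite lift2_rshift.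
rewrite -[RHS]/(2 ^- p.+1 * \sum_s G s) [LHS]/= /wedge.
transitivity ((2`! * (p * 2)`!)%:R^-1 * \sum_(s : 'S_(2 + p * 2))
   \sum_(t : 'S_(p * 2)) 2 ^- p * G (lift2 t * s)%g).
  congr (_ * _); apply: eq_bigr => s _; rewrite IHp mulrCA -mulr_sumr.
  congr (_ * _); rewrite mulr_sumr; apply: eq_bigr => t _; exact/esym/GE.
rewrite exchange_big /= (eq_bigr (fun=> 2 ^- p * \sum_s G s)); last first.
  move=> t _; rewrite -mulr_sumr; congr (_ * _).
  by rewrite [RHS](reindex_inj (mulgI (lift2 t))).
rewrite sumr_const card_Sn natrM -[X in _ * X]mulr_natl.
rewrite (invfM 2) -mulrA mulKf ?pnatr_eq0 -?lt0n ?fact_gt0//.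
by rewrite mulrA exprS invfM.
Qed.

End WedgePower.

(** * Sections, cosections and connections *)

Section Sections.
Context {R : realType} {m : nat} {M : manifold R m} {r : nat} {E : vbundle M r}.
Implicit Types (U V : set M) (s t : section E) (f : M -> R).
Implicit Types (phi psi : cosection E).

Lemma smooth_section_sub U V s :
  V `<=` U -> smooth_section U s -> smooth_section V s.
Proof.
by move=> VU Us a i; apply: smooth_on_sub (Us a i); exact: setSI.
Qed.

Lemma smooth_sectionD U s t : open U ->
  smooth_section U s -> smooth_section U t ->
  smooth_section U (fun x => s x + t x).
Proof.
move=> Uo Us Ut a i; under eq_fun do rewrite linearD.
apply: smooth_onD; [|exact: Us|exact: Ut].
by apply: openI => //; exact: bdom_open.
Qed.

Lemma smooth_sectionZ U f s : open U -> smooth_on U f -> smooth_section U s ->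
  smooth_section U (fun x => f x *: s x).
Proof.
move=> Uo Uf Us a i; under eq_fun do rewrite linearZ.
apply: smooth_onM; last exact: Us.
  by apply: openI => //; exact: bdom_open.
by apply: smooth_on_sub Uf => x [].
Qed.

Lemma smooth_sectionN U s : open U -> smooth_section U s ->
  smooth_section U (fun x => - s x).
Proof.
move=> Uo Us; have -> : (fun x => - s x) = (fun x => (-1 : R) *: s x).
  by apply/functional_extensionality_dep => x; rewrite scaleN1r.
by apply: smooth_sectionZ => //; exact: smooth_on_cst.
Qed.

Lemma smooth_section0 U : smooth_section U (fun x => 0 : E x).
Proof.
by move=> a i; under eq_fun do rewrite linear0; exact: smooth_on_cst.
Qed.

Lemma smooth_section_bframe (a : bidx E) i :
  smooth_section (bdom a) (fun x => tnth (bframe a x) i).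
Proof. by move=> b j; rewrite setIC; exact: bframe_smooth. Qed.

Lemma smooth_section_nearD s t x :
  smooth_section_near s x -> smooth_section_near t x ->
  smooth_section_near (fun x => s x + t x) x.
Proof.
move=> [U [Uo Ux Us]] [V [Vo Vx Vt]]; have UVo := openI Uo Vo.
exists (U `&` V); split=> //; apply: smooth_sectionD => //.
  exact: smooth_section_sub Us.
exact: smooth_section_sub Vt.
Qed.

Lemma smooth_section_nearZ f s x : smooth_near f x -> smooth_section_near s x ->
  smooth_section_near (fun x => f x *: s x) x.
Proof.
move=> [U [Uo Ux Uf]] [V [Vo Vx Vt]]; have UVo := openI Uo Vo.
exists (U `&` V); split=> //; apply: smooth_sectionZ => //.
  exact: smooth_on_sub Uf.
exact: smooth_section_sub Vt.
Qed.

Lemma smooth_section_nearN s x : smooth_section_near s x ->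
  smooth_section_near (fun x => - s x) x.
Proof.
by move=> [U [Uo Ux Us]]; exists U; split=> //; exact: smooth_sectionN.
Qed.

Lemma smooth_section_near0 x : smooth_section_near (fun x => 0 : E x) x.
Proof.
by exists setT; split=> //; [exact: openT|exact: smooth_section0].
Qed.

Lemma smooth_section_near_sum (I : Type) (q : seq I) (F : I -> section E) x :
  (forall i, smooth_section_near (F i) x) ->
  smooth_section_near (fun x => \sum_(i <- q) F i x) x.
Proof.
move=> FF; elim: q => [|i q IHq].
  have -> : (fun x => \sum_(i <- [::]) F i x) = (fun x => 0 : E x).
    by apply/functional_extensionality_dep => y; rewrite big_nil.
  exact: smooth_section_near0.
have -> : (fun x => \sum_(j <- i :: q) F j x) =
    (fun x => F i x + \sum_(j <- q) F j x).
  by apply/functional_extensionality_dep => y; rewrite big_cons.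
exact: smooth_section_nearD.
Qed.

Lemma smooth_section_near_bframe x i :
  smooth_section_near (fun y => tnth (bframe (bat E x) y) i) x.
Proof.
exists (bdom (bat E x)); split; [exact: bdom_open|exact: bdom_bat|].
exact: smooth_section_bframe.
Qed.

Lemma smooth_section_near_extend x (w : E x) : smooth_section_near (extend w) x.
Proof.
apply: smooth_section_near_sum => i; apply: smooth_section_nearZ.
  exact: smooth_near_cst.
exact: smooth_section_near_bframe.
Qed.

Lemma bframe_coord (a : bidx E) x (w : E x) : bdom a x ->
  w = \sum_i coord (bframe a x) i w *: tnth (bframe a x) i.
Proof.
move=> /bframe_basis bx; rewrite [LHS](coord_basis bx (memvf w)).
by apply: eq_bigr => i _; rewrite (tnth_nth 0).
Qed.

Lemma extendE x (w : E x) : extend w x = w.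
Proof. exact/esym/bframe_coord/bdom_bat. Qed.

Lemma smooth_near_pairing phi s x :
  smooth_cosection_near phi x -> smooth_section_near s x ->
  smooth_near (fun y => phi y (s y) : R) x.
Proof.
move=> [U [Uo Ux Uphi]] [V [Vo Vx Vs]]; pose a := bat E x.
pose W := (U `&` V) `&` bdom a.
have Wo : open W by apply: openI; [exact: openI|exact: bdom_open].
exists W; split=> //; first by split=> //; exact: bdom_bat.
apply: (@eq_smooth_on _ _ _ _ (fun y => \sum_i
    coord (bframe a y) i (s y) * phi y (tnth (bframe a y) i))) => //.
  move=> y [_ ay]; rewrite [in RHS](bframe_coord (s y) ay) linear_sum.
  by apply: eq_bigr => i _; rewrite linearZ.
apply: smooth_on_sum => // i; apply: smooth_onM => //.
  by apply: smooth_on_sub (Vs a i) => y [[]].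
by apply: smooth_on_sub (Uphi a i) => y [[]].
Qed.

Section Connection.
Context (nabla : connection E) {x : M} (v : tangent x).

Lemma conn0 : nabla (fun y => 0 : E y) x v = 0.
Proof.
have := conn_add nabla v (smooth_section_near0 x) (smooth_section_near0 x).
have -> : (fun y => (0 : E y) + 0) = (fun y => 0 : E y).
  by apply/functional_extensionality_dep => y; rewrite addr0.
by move/esym/eqP; rewrite -subr_eq0 addrK => /eqP.
Qed.

Lemma conn_sum (I : Type) (q : seq I) (F : I -> section E) :
  (forall i, smooth_section_near (F i) x) ->
  nabla (fun y => \sum_(i <- q) F i y) x v = \sum_(i <- q) nabla (F i) x v.
Proof.
move=> FF; elim: q => [|i q IHq].
  have -> : (fun x => \sum_(i <- [::]) F i x) = (fun x => 0 : E x).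
    by apply/functional_extensionality_dep => y; rewrite big_nil.
  by rewrite conn0 big_nil.
have -> : (fun x => \sum_(j <- i :: q) F j x) =
    (fun x => F i x + \sum_(j <- q) F j x).
  by apply/functional_extensionality_dep => y; rewrite big_cons.
rewrite conn_add//; first by rewrite IHq big_cons.
exact: smooth_section_near_sum.
Qed.

(** [v (phi s) - phi (nabla_v s)], which depends on [s] through its value at [x]
    only: it is the value of [nabla_v phi] at [s x]. *)
Let defect phi s : R := v (fun y => phi y (s y) : R) - phi x (nabla s x v).

Let defect_lincomb phi (I : Type) (q : seq I) (f : I -> M -> R)
    (F : I -> section E) :
  smooth_cosection_near phi x ->
  (forall i, smooth_near (f i) x) -> (forall i, smooth_section_near (F i) x) ->
  defect phi (fun y => \sum_(i <- q) f i y *: F i y) =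
  \sum_(i <- q) f i x * defect phi (F i).
Proof.
move=> Hphi Hf HF; rewrite /defect.
have HfF i : smooth_section_near (fun y => f i y *: F i y) x.
  exact: smooth_section_nearZ.
have -> : (fun y => phi y (\sum_(i <- q) f i y *: F i y) : R) =
    (fun y => \sum_(i <- q) f i y * (phi y (F i y) : R)).
  apply/funext => y; rewrite linear_sum; apply: eq_bigr => i _.
  by rewrite linearZ.
rewrite tangent_sum; last first.
  by move=> i; apply: smooth_nearM => //; exact: smooth_near_pairing.
rewrite conn_sum// linear_sum -sumrB; apply: eq_bigr => i _.
rewrite tact_leibniz//; last exact: smooth_near_pairing.
rewrite conn_leibniz// linearD !linearZ /= [phi x (F i x) * _]mulrC.
by rewrite mulrBr opprD addrA addrK.
Qed.

Let defect_local phi s t :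
  smooth_cosection_near phi x -> smooth_section_near s x ->
  smooth_section_near t x -> (\forall y \near x, s y = t y) ->
  defect phi s = defect phi t.
Proof.
move=> Hphi Hs Ht st; rewrite /defect (conn_local nabla v Hs Ht st).
congr (_ - _); apply: tact_local; [exact: smooth_near_pairing..|].
by apply: filterS st => y ->.
Qed.

Let defect_value phi s :
  smooth_cosection_near phi x -> smooth_section_near s x ->
  defect phi s = \sum_i coord (bframe (bat E x) x) i (s x) *
                   defect phi (fun y => tnth (bframe (bat E x) y) i).
Proof.
move=> Hphi Hs.
have Hc i : smooth_near (fun y => coord (bframe (bat E x) y) i (s y)) x.
  have [U [Uo Ux Us]] := Hs.
  exists (U `&` bdom (bat E x)).
  split; [|by split=> //; exact: bdom_bat|exact: Us].
  by apply: openI => //; exact: bdom_open.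
have Hb i := @smooth_section_near_bframe x i.
have <- := defect_lincomb (index_enum _) Hphi Hc Hb.
apply: defect_local => //.
  by apply: smooth_section_near_sum => i; exact: smooth_section_nearZ.
have : nbhs x (bdom (bat E x)).
  by apply: open_nbhs_nbhs; split; [exact: bdom_open|exact: bdom_bat].
by apply: filterS => y; exact: bframe_coord.
Qed.

(** The Leibniz rule defining the dual connection holds for every local section,
    and not only for the extensions chosen in [dual_conn]. *)
Lemma dual_connE phi s :
  smooth_cosection_near phi x -> smooth_section_near s x ->
  v (fun y => phi y (s y) : R) =
  dual_conn nabla phi v (s x) + phi x (nabla s x v).
Proof.
move=> Hphi Hs; pose c (w : E x) : R^o := defect phi (extend w).
have cE w : c w = \sum_i coord (bframe (bat E x) x) i w *
                   defect phi (fun y => tnth (bframe (bat E x) y) i).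
  rewrite /c defect_value//; last exact: smooth_section_near_extend.
  by rewrite extendE.
have c_linear : linear c.
  move=> a w w'; rewrite !cE scaler_sumr -big_split; apply: eq_bigr => i _ /=.
  by rewrite linearP /= mulrDl -mulrA.
pose L : {linear E x -> R^o} :=
  HB.pack c (GRing.isLinear.Build _ _ _ _ c c_linear).
have -> : dual_conn nabla phi v (s x) = c (s x) by rewrite /dual_conn (lfunE L).
by rewrite cE -defect_value// subrK.
Qed.

Lemma near_eq_dual_conn phi psi :
  smooth_cosection_near phi x -> smooth_cosection_near psi x ->
  (\forall y \near x, phi y = psi y) ->
  dual_conn nabla phi v = dual_conn nabla psi v.
Proof.
move=> Hphi Hpsi pp; apply/lfunP => w; rewrite -[w]extendE.
have Hw := @smooth_section_near_extend x w.
apply: (addIr (phi x (nabla (extend w) x v))).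
rewrite -dual_connE// [in RHS](nbhs_singleton pp) -dual_connE//.
apply: tact_local; [exact: smooth_near_pairing..|].
by apply: filterS pp => y ->.
Qed.

End Connection.

Section Metric.
Context (h : bilinear_field E) (h_smooth : smooth_bilinear h).

Lemma smooth_cosection_flat U s x : open U -> U x -> smooth_section U s ->
  smooth_cosection_near (fun y => h y (s y)) x.
Proof.
move=> Uo Ux Us; exists U; split=> // a i.
apply: h_smooth; first by apply: openI => //; exact: bdom_open.
  by apply: smooth_section_sub Us => y [].
by apply: smooth_section_sub (smooth_section_bframe a i) => y [].
Qed.

Lemma smooth_cosection_near_flat s x : smooth_section_near s x ->
  smooth_cosection_near (fun y => h y (s y)) x.
Proof. by move=> [U [Uo Ux Us]]; exact: smooth_cosection_flat Us. Qed.

(** Lowering an index commutes with covariant differentiation. *)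
Lemma dual_conn_flat (nabla : connection E) s x (v : tangent x) :
  metric_connection h nabla -> smooth_section_near s x ->
  dual_conn nabla (fun y => h y (s y)) v = h x (nabla s x v).
Proof.
move=> hn Hs; apply/lfunP => w; rewrite -[w]extendE.
have Hw := @smooth_section_near_extend x w.
have Hf := smooth_cosection_near_flat Hs.
apply: (addIr (h x (s x) (nabla (extend w) x v))).
by rewrite -(dual_connE nabla v Hf Hw) hn.
Qed.

End Metric.
End Sections.

(** * Frames adapted to a nilpotent endomorphism *)

Lemma lfunD (R : realType) (V W : vectType R) (f : 'Hom(V, W)) u w :
  f (u + w) = f u + f w.
Proof. exact: linearD. Qed.

Lemma lfunN (R : realType) (V W : vectType R) (f : 'Hom(V, W)) u :
  f (- u) = - f u.
Proof. exact: linearN. Qed.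

Lemma lfunB (R : realType) (V W : vectType R) (f : 'Hom(V, W)) u w :
  f (u - w) = f u - f w.
Proof. exact: linearB. Qed.

Lemma lfunZ (R : realType) (V W : vectType R) (f : 'Hom(V, W)) a u :
  f (a *: u) = a *: f u.
Proof. exact: linearZ. Qed.

Lemma lfun_sum (R : realType) (V W : vectType R) (f : 'Hom(V, W)) (I : Type)
    (r : seq I) (F : I -> V) : f (\sum_(i <- r) F i) = \sum_(i <- r) f (F i).
Proof. exact: linear_sum. Qed.

Lemma sum_symplectic_mx (R : realType) (V : lmodType R) p
    (G : 'I_(p * 2) -> 'I_(p * 2) -> V) :
  \sum_a \sum_b symplectic_mx R p a b *: G a b =
  \sum_(k < p) (G (even_ord k) (odd_ord k) - G (odd_ord k) (even_ord k)).
Proof.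
rewrite big_pair_ord; apply: eq_bigr => k _; congr (_ + _).
  rewrite (bigD1 (odd_ord k)) //= symplectic_even eqxx scale1r big1 ?addr0//.
  by move=> b /negPf bk; rewrite symplectic_even bk scale0r.
rewrite (bigD1 (even_ord k)) //= symplectic_odd eqxx scaleN1r big1 ?addr0//.
by move=> b /negPf bk; rewrite symplectic_odd bk oppr0 scale0r.
Qed.

Section NilpotentFrame.
Context {R : realType} {V : vectType R} {n : nat}.
Variables (h : 'Hom(V, dual V)) (N : 'End(V)).
Local Notation J := (symplectic_mx R n).

(** The [q a] and the [N (q a)] together behave as a basis in which [h] pairs
    the [q a] with the [N (q a)] through the symplectic matrix [J]. The last clause
    is the expansion of a vector; as [J] squares to [- 1], its coefficients are
    the products of [h z] with the basis, up to the signs in [J]. Spanning and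
    nondegeneracy of [h] are read off from it. *)
Definition nilpotent_frame (q : 'I_(n * 2) -> V) : Prop :=
  [/\ forall a b, h (q a) (N (q b)) = J a b,
      forall a, N (N (q a)) = 0 &
      forall z, z = \sum_a \sum_b J a b *:
        ((h (N (q b)) z : R) *: q a - (h (q b) z : R) *: N (q a))].

Context (hC : forall u w, h u w = h w u) {q : 'I_(n * 2) -> V}.
Context (qP : nilpotent_frame q).

Let NNq a : N (N (q a)) = 0. Proof. by have [_ + _] := qP; apply. Qed.
Let q_expand z : z = \sum_a \sum_b J a b *:
  ((h (N (q b)) z : R) *: q a - (h (q b) z : R) *: N (q a)).
Proof. by have [_ _ +] := qP; apply. Qed.

Lemma nilpotent_frameE z :
  N z = \sum_a \sum_b J a b *: ((h (N (q b)) z : R) *: N (q a)).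
Proof.
rewrite [in LHS](q_expand z) lfun_sum; apply: eq_bigr => a _.
rewrite lfun_sum; apply: eq_bigr => b _.
by rewrite lfunZ lfunB !lfunZ NNq scaler0 subr0.
Qed.

Let hN z w :
  h (N z) w = \sum_a \sum_b J a b * (h (N (q b)) z * h (N (q a)) w) :> R.
Proof.
rewrite nilpotent_frameE lfun_sum sum_lfunE; apply: eq_bigr => a _.
rewrite lfun_sum sum_lfunE; apply: eq_bigr => b _.
by rewrite !lfunZ !scale_lfunE.
Qed.

Lemma nilpotent_frame_skew z w : h (N z) w = - h z (N w).
Proof.
rewrite [h z _]hC !hN exchange_big -sumrN; apply: eq_bigr => a _.
rewrite -sumrN; apply: eq_bigr => b _.
by rewrite symplectic_mxC mulNr [_ * h _ w]mulrC.
Qed.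

Lemma nilpotent_frame_sqr z : N (N z) = 0.
Proof.
rewrite [in N z]nilpotent_frameE lfun_sum big1// => a _.
by rewrite lfun_sum big1// => b _; rewrite !lfunZ NNq !scaler0.
Qed.

(** With [nilpotent_frame_limg]: the kernel of [N] is its image, and the
    [N (q a)] span it. *)
Lemma nilpotent_frame_ker z : N z = 0 ->
  z = \sum_a (- \sum_b J a b * h (q b) z) *: N (q a).
Proof.
move=> Nz0; rewrite [LHS]q_expand; apply: eq_bigr => a _.
rewrite -sumrN scaler_suml; apply: eq_bigr => b _.
rewrite nilpotent_frame_skew Nz0 linear0 oppr0 scale0r sub0r.
by rewrite scalerN scalerA scaleNr.
Qed.

Lemma nilpotent_frame_limg z : (z \in limg N) = (N z == 0).
Proof.
apply/idP/eqP => [/memv_imgP[w _ ->]|/nilpotent_frame_ker ->].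
  exact: nilpotent_frame_sqr.
by apply: memv_suml => a _; apply: memvZ; apply: memv_img; exact: memvf.
Qed.

Lemma nilpotent_frame_nondegenerate z : (forall a, h (q a) z = 0) ->
  (forall a, h (N (q a)) z = 0) -> z = 0.
Proof.
move=> hz hNz; rewrite [z]q_expand big1// => a _; rewrite big1// => b _.
by rewrite hz hNz !scale0r subr0 scaler0.
Qed.

Lemma nilpotent_frame_lker : lker h == 0%VS.
Proof.
apply/lker0P => u w uw; apply/eqP; rewrite -subr_eq0; apply/eqP.
by apply: nilpotent_frame_nondegenerate => a;
  rewrite hC lfunB add_lfunE opp_lfunE uw subrr.
Qed.

(** The vector that represents a covector, expressed in the frame. *)
Lemma nilpotent_frame_sharp (phi : dual V) :
  phi = h (\sum_a \sum_b J a b *: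
             ((phi (q a) : R) *: N (q b) - (phi (N (q a)) : R) *: q b)).
Proof.
apply/lfunP => z; rewrite {1}[z]q_expand !lfun_sum sum_lfunE.
apply: eq_bigr => a _; rewrite !lfun_sum sum_lfunE; apply: eq_bigr => b _.
rewrite !lfunZ !lfunB !lfunZ scale_lfunE add_lfunE opp_lfunE.
by rewrite !scale_lfunE; congr (_ *: (_ - _)); exact: mulrC.
Qed.

End NilpotentFrame.

(** * Adapted frames from pseudo-orthonormal frames *)

Section BlockIndices.
Context {n : nat}.

(** The four blocks of [n] indices among the [4 n] ones. *)
Definition block1 (k : 'I_n) : 'I_(rank4 n) := lshift (n + n) (lshift n k).
Definition block2 (k : 'I_n) : 'I_(rank4 n) := lshift (n + n) (rshift n k).
Definition block3 (k : 'I_n) : 'I_(rank4 n) := rshift (n + n) (lshift n k).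
Definition block4 (k : 'I_n) : 'I_(rank4 n) := rshift (n + n) (rshift n k).

Definition blockE := (block_mxEul, block_mxEur, block_mxEdl, block_mxEdr,
  eq_lshift, eq_rshift, eq_lrshift, eq_rlshift).

Lemma sum_blocks (V : nmodType) (F : 'I_(rank4 n) -> V) :
  \sum_i F i = \sum_k F (block1 k) + \sum_k F (block2 k) +
               (\sum_k F (block3 k) + \sum_k F (block4 k)).
Proof. by rewrite !big_split_ord. Qed.

Lemma block_ind (P : 'I_(rank4 n) -> Prop) :
  (forall k, P (block1 k)) -> (forall k, P (block2 k)) ->
  (forall k, P (block3 k)) -> (forall k, P (block4 k)) -> forall i, P i.
Proof.
move=> P1 P2 P3 P4 i; rewrite -(splitK i).
case: (fintype.split i) => j /=; rewrite -(splitK j);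
by case: (fintype.split j).
Qed.

End BlockIndices.

Lemma neutral_mx_diag (R : realType) n (i j : 'I_(rank4 n)) :
  i != j -> neutral_mx R n i j = 0.
Proof.
rewrite /neutral_mx; elim/(@block_ind n): i => k; elim/(@block_ind n): j => l;
by rewrite /block1 /block2 /block3 /block4 !blockE !mxE ?blockE// => /negPf ij;
  rewrite ?ij ?mulr0n ?oppr0.
Qed.

Lemma neutral_mx_sqr (R : realType) n (i : 'I_(rank4 n)) :
  neutral_mx R n i i * neutral_mx R n i i = 1.
Proof.
rewrite /neutral_mx; elim/(@block_ind n): i => k;
by rewrite /block1 /block2 /block3 /block4 !blockE !mxE ?eqxx ?mulrNN mulr1.
Qed.

Section AdaptedFrame.
Context {R : realType} {V : vectType R} {n : nat}.

(** For a pseudo-orthonormal frame [E] in which [N] has matrix [Lambda], with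
    blocks [E1], ..., [E4]: the vectors [(E1 + E3) / 2] at the even indices and
    [(E4 - E2) / 2] at the odd ones. They span an isotropic complement of the
    image of [N], and [N] maps them to [E2 + E4] and [E1 - E3]. *)
Definition adapted_frame (E : 'I_(rank4 n) -> V) (a : 'I_(n * 2)) : V :=
  let k := half_ord a in
  if odd a then 2^-1 *: (E (block4 k) - E (block2 k))
  else 2^-1 *: (E (block1 k) + E (block3 k)).

Local Notation crd := (coord (vbasis (fullv : {vspace V}))).

Let crdD i u w : crd i (u + w) = crd i u + crd i w.
Proof. exact: linearD. Qed.

Let crdN i u : crd i (- u) = - crd i u.
Proof. exact: linearN. Qed.

Let crdZ i a u : crd i (a *: u) = a * crd i u.
Proof. exact: linearZ. Qed.

Let crd_inj u w : (forall i, crd i u = crd i w) -> u = w.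
Proof.
move=> uw; rewrite [u](coord_vbasis (memvf u)) [RHS](coord_vbasis (memvf w)).
by apply: eq_bigr => i _; rewrite uw.
Qed.

Variables (h : 'Hom(V, dual V)) (N : 'End(V)) (E : 'I_(rank4 n) -> V).
Hypothesis E_gram : forall i j, h (E i) (E j) = neutral_mx R n i j.
Hypothesis E_expand :
  forall z, z = \sum_i (neutral_mx R n i i * h (E i) z) *: E i.
Hypothesis NE1 : forall l, N (E (block1 l)) = E (block2 l) + E (block4 l).
Hypothesis NE2 : forall l, N (E (block2 l)) = E (block3 l) - E (block1 l).
Hypothesis NE3 : forall l, N (E (block3 l)) = E (block2 l) + E (block4 l).
Hypothesis NE4 : forall l, N (E (block4 l)) = E (block1 l) - E (block3 l).
Local Notation q := (adapted_frame E).

Let frame_even k :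
  q (even_ord k) = 2^-1 *: (E (block1 k) + E (block3 k)).
Proof. by rewrite /adapted_frame odd_even_ord half_even_ord. Qed.

Let frame_odd k :
  q (odd_ord k) = 2^-1 *: (E (block4 k) - E (block2 k)).
Proof. by rewrite /adapted_frame odd_odd_ord half_odd_ord. Qed.

Let half_double (W : lmodType R) (w : W) : 2^-1 *: (w + w) = w.
Proof.
by rewrite scalerDr -scalerDl -[RHS]scale1r [in RHS](splitr 1) mul1r.
Qed.

Let N_even k : N (q (even_ord k)) = E (block2 k) + E (block4 k).
Proof. by rewrite frame_even lfunZ lfunD NE1 NE3 half_double. Qed.

Let N_odd k : N (q (odd_ord k)) = E (block1 k) - E (block3 k).
Proof. by rewrite frame_odd lfunZ lfunB NE4 NE2 opprB half_double. Qed.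

Lemma nilpotent_frame_adapted : nilpotent_frame h N q.
Proof.
split=> [a b|a|z].
- elim/double_ord_ind: a => k; elim/double_ord_ind: b => l;
  rewrite ?symplectic_even ?symplectic_odd ?N_even ?N_odd;
  rewrite ?frame_even ?frame_odd;
  rewrite !(lfunZ, lfunD, lfunN, scale_lfunE, add_lfunE, opp_lfunE) !E_gram;
  rewrite /neutral_mx /block1 /block2 /block3 /block4 !blockE !mxE ?blockE.
  + by rewrite even_odd_neq mulr0n oppr0 !addr0 scaler0 addr0.
  + rewrite odd_ord_eq (eq_sym l) addr0 sub0r scalerN opprK.
    by rewrite -scalerDr half_double.
  + by rewrite even_ord_eq (eq_sym l) sub0r subr0 -scalerDr half_double.
  + by rewrite odd_even_neq !mulr0n oppr0 !addr0 scaler0 oppr0 addr0.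
- elim/double_ord_ind: a => k; rewrite ?N_even ?N_odd.
    by rewrite lfunD NE2 NE4 addrA subrK subrr.
  by rewrite lfunB NE1 NE3 subrr.
rewrite sum_symplectic_mx [LHS]E_expand sum_blocks -!big_split.
apply: eq_bigr => k _ /=.
rewrite !N_even !N_odd !frame_even !frame_odd.
rewrite !(lfunZ, lfunD, lfunN, scale_lfunE, add_lfunE, opp_lfunE).
rewrite /neutral_mx /block1 /block2 /block3 /block4 !blockE !mxE !eqxx.
rewrite !mul1r !mulN1r; set c1 : R := h (E _) z; set c2 : R := h (E _) z.
set c3 : R := h (E _) z; set c4 : R := h (E _) z.
apply: crd_inj => i; rewrite !(crdZ, crdD, crdN).
rewrite -[2^-1 *: (c4 - c2)]/(2^-1 * (c4 - c2)).
rewrite -[2^-1 *: (c1 + c3)]/(2^-1 * (c1 + c3)).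
by field.
Qed.

End AdaptedFrame.

Section NilpotentTuple.
Context {R : realType} {V : vectType R} {n : nat}.
Variables (h : 'Hom(V, dual V)) (N : 'End(V)) (eps : bool).
Variable e : (rank4 n).-tuple V.
Hypothesis e_basis : basis_of fullv e.
Hypothesis e_gram : forall i j, h (tnth e i) (tnth e j) = neutral_mx R n i j.
Hypothesis Ne : tuple_mulmx (map_tuple N e) (I'_sign R n eps) =
                tuple_mulmx (tuple_mulmx e (I'_sign R n eps)) (Lambda R n).

(** The diagonal of [I']. *)
Let d (i : 'I_(rank4 n)) : R := I'_sign R n eps i i.

Let I'_signE i j : I'_sign R n eps i j = d j *+ (i == j).
Proof.
rewrite /d /I'_sign; elim/(@block_ind n): i => k; elim/(@block_ind n): j => l;
rewrite /block1 /block2 /block3 /block4 !blockE !mxE ?blockE ?eqxx ?mulr1n//;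
by have [->|/negPf kl] := eqVneq k l; rewrite ?kl ?eqxx ?mulr1n ?mulr0n.
Qed.

Let d_sqr i : d i * d i = 1.
Proof.
rewrite /d /I'_sign; elim/(@block_ind n): i => k;
rewrite /block1 /block2 /block3 /block4 !blockE !mxE eqxx ?mulr1n ?mulr1//.
by case: ifP => _; rewrite ?mulr1// -expr2 sqrr_sign.
Qed.

(** The frame [e I'] of the definition of a nilpotent structure. *)
Let E i : V := d i *: tnth e i.

Let tuple_mulmx_sign (f : (rank4 n).-tuple V) j :
  tnth (tuple_mulmx f (I'_sign R n eps)) j = d j *: tnth f j.
Proof.
rewrite tnth_mktuple (bigD1 j) //= I'_signE eqxx big1 ?addr0// => i /negPf ij.
by rewrite I'_signE ij scale0r.
Qed.

Let NE j : N (E j) = \sum_i Lambda R n i j *: E i.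
Proof.
have := congr1 (fun t => tnth t j) Ne.
rewrite tuple_mulmx_sign tnth_map -lfunZ => ->; rewrite tnth_mktuple.
by apply: eq_bigr => i _; rewrite tuple_mulmx_sign.
Qed.

Let sum_delta (F : 'I_n -> V) k (c : R) :
  \sum_l (c *+ (l == k)) *: F l = c *: F k.
Proof.
rewrite (bigD1 k) //= eqxx big1 ?addr0// => l /negPf lk.
by rewrite lk scale0r.
Qed.

Let NE_blocks (c1 c2 c3 c4 : R) j l :
  (forall k, Lambda R n (block1 k) j = c1 *+ (k == l)) ->
  (forall k, Lambda R n (block2 k) j = c2 *+ (k == l)) ->
  (forall k, Lambda R n (block3 k) j = c3 *+ (k == l)) ->
  (forall k, Lambda R n (block4 k) j = c4 *+ (k == l)) ->
  N (E j) = c1 *: E (block1 l) + c2 *: E (block2 l) +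
            (c3 *: E (block3 l) + c4 *: E (block4 l)).
Proof.
move=> H1 H2 H3 H4; rewrite NE sum_blocks; congr (_ + _ + (_ + _));
  [under eq_bigr do rewrite H1|under eq_bigr do rewrite H2
  |under eq_bigr do rewrite H3|under eq_bigr do rewrite H4];
exact: (sum_delta (fun k => E (_ k))).
Qed.

Let LambdaE (k l : 'I_n) :
  (Lambda R n (block1 k) (block1 l) = 0) *
  (Lambda R n (block1 k) (block2 l) = - 1 *+ (k == l)) *
  (Lambda R n (block1 k) (block3 l) = 0) *
  (Lambda R n (block1 k) (block4 l) = 1 *+ (k == l)) *
  (Lambda R n (block2 k) (block1 l) = 1 *+ (k == l)) *
  (Lambda R n (block2 k) (block2 l) = 0) *
  (Lambda R n (block2 k) (block3 l) = 1 *+ (k == l)) *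
  (Lambda R n (block2 k) (block4 l) = 0) *
  (Lambda R n (block3 k) (block1 l) = 0) *
  (Lambda R n (block3 k) (block2 l) = 1 *+ (k == l)) *
  (Lambda R n (block3 k) (block3 l) = 0) *
  (Lambda R n (block3 k) (block4 l) = - 1 *+ (k == l)) *
  (Lambda R n (block4 k) (block1 l) = 1 *+ (k == l)) *
  (Lambda R n (block4 k) (block2 l) = 0) *
  (Lambda R n (block4 k) (block3 l) = 1 *+ (k == l)) *
  (Lambda R n (block4 k) (block4 l) = 0).
Proof.
do !split; rewrite /Lambda /block1 /block2 /block3 /block4 !blockE !mxE//;
by rewrite mulNrn.
Qed.

Let E_gram i j : h (E i) (E j) = neutral_mx R n i j.
Proof.
rewrite /E !lfunZ scale_lfunE e_gram.
have [<-|ij] := eqVneq i j; first by rewrite scalerA d_sqr scale1r.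
by rewrite (neutral_mx_diag _ ij) !scaler0.
Qed.

Let NE1 l : N (E (block1 l)) = E (block2 l) + E (block4 l).
Proof.
rewrite (@NE_blocks 0 1 0 1 _ l) => [|k|k|k|k]; rewrite ?LambdaE ?mul0rn//.
by rewrite !scale0r !scale1r !add0r.
Qed.

Let NE2 l : N (E (block2 l)) = E (block3 l) - E (block1 l).
Proof.
rewrite (@NE_blocks (- 1) 0 1 0 _ l) => [|k|k|k|k]; rewrite ?LambdaE ?mul0rn//.
by rewrite !scale0r !scale1r !addr0 scaleN1r addrC.
Qed.

Let NE3 l : N (E (block3 l)) = E (block2 l) + E (block4 l).
Proof.
rewrite (@NE_blocks 0 1 0 1 _ l) => [|k|k|k|k]; rewrite ?LambdaE ?mul0rn//.
by rewrite !scale0r !scale1r !add0r.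
Qed.

Let NE4 l : N (E (block4 l)) = E (block1 l) - E (block3 l).
Proof.
rewrite (@NE_blocks 1 0 (- 1) 0 _ l) => [|k|k|k|k]; rewrite ?LambdaE ?mul0rn//.
by rewrite !scale0r !scale1r !addr0 scaleN1r.
Qed.

Let E_expand z : z = \sum_i (neutral_mx R n i i * h (E i) z) *: E i.
Proof.
have hz i : h (tnth e i) z = neutral_mx R n i i * coord e i z.
  rewrite [in LHS](coord_basis e_basis (memvf z)) lfun_sum (bigD1 i) //=.
  rewrite -(tnth_nth 0) lfunZ e_gram big1 ?addr0 1?[RHS]mulrC// => j.
  rewrite eq_sym => ij.
  by rewrite -(tnth_nth 0) lfunZ e_gram (neutral_mx_diag _ ij) scaler0.
rewrite [LHS](coord_basis e_basis (memvf z)); apply: eq_bigr => i _.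
rewrite -(tnth_nth 0) /E lfunZ scale_lfunE scalerA hz; congr (_ *: _).
transitivity
  (d i * d i * (neutral_mx R n i i * neutral_mx R n i i) * coord e i z).
  by rewrite d_sqr neutral_mx_sqr !mul1r.
by rewrite -[d i *: (_ * _)]/(d i * (_ * _)); ring.
Qed.

Lemma nilpotent_frame_tuple : nilpotent_frame h N (adapted_frame E).
Proof. exact: nilpotent_frame_adapted. Qed.

End NilpotentTuple.

(** * Determinants with one row replaced *)

Section DeterminantRows.
Context {R : comNzRingType} {k : nat}.
Implicit Types A B : 'M[R]_k.

Lemma det_replace_row A i (u : 'I_k -> R) :
  \det (\matrix_(a, b) if a == i then u b else A a b) =
  \sum_b u b * cofactor A i b.
Proof.
rewrite (expand_det_row _ i); apply: eq_bigr => b _.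
rewrite mxE eqxx; congr (_ * _); rewrite /cofactor; congr (_ * \det _).
by apply/matrixP => c d; rewrite !mxE eq_sym (negPf (neq_lift _ _)).
Qed.

Lemma det_replace_rowD A i (u w : 'I_k -> R) :
  \det (\matrix_(a, b) if a == i then u b + w b else A a b) =
  \det (\matrix_(a, b) if a == i then u b else A a b) +
  \det (\matrix_(a, b) if a == i then w b else A a b).
Proof.
by rewrite !det_replace_row -big_split; apply: eq_bigr => b _; rewrite mulrDl.
Qed.

Lemma sum_det_replace_row_mul A B :
  \sum_i \det (\matrix_(a, b) if a == i then (A *m B) i b else A a b) =
  \tr B * \det A.
Proof.
transitivity (\tr (A *m B *m \adj A)).
  apply: eq_bigr => i _; rewrite det_replace_row mxE.
  by apply: eq_bigr => b _; rewrite [\adj A _ _]mxE.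
by rewrite mxtrace_mulC mulmxA mul_adj_mx mul_scalar_mx mxtraceZ mulrC.
Qed.

Lemma det_row0 A i : (forall b, A i b = 0) -> \det A = 0.
Proof.
by move=> A0; rewrite (expand_det_row _ i) big1// => b _; rewrite A0 mul0r.
Qed.

End DeterminantRows.

Lemma smooth_near_det (R : realType) (m k : nat) (M : manifold R m)
    (A : 'I_k -> 'I_k -> M -> R) x : (forall a b, smooth_near (A a b) x) ->
  smooth_near (fun y => \det (\matrix_(a, b) A a b y)) x.
Proof.
move=> HA; apply: smooth_near_sum => s; apply: smooth_nearM.
  exact: smooth_near_cst.
by apply: smooth_near_prod => i; under eq_fun do rewrite mxE.
Qed.

Lemma eq_smooth_near (R : realType) (m : nat) (M : manifold R m) (U : set M)
    (f g : M -> R) x : open U -> U x -> (forall y, U y -> f y = g y) ->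
  smooth_near f x -> smooth_near g x.
Proof.
move=> Uo Ux fg [V [Vo Vx Vf]]; have UVo := openI Uo Vo.
exists (U `&` V); split=> //; apply: (@eq_smooth_on _ _ _ _ f) => //.
  by move=> y [Uy _]; exact: fg.
exact: smooth_on_sub Vf.
Qed.

Lemma symplectic_mx_unit (R : realType) p : symplectic_mx R p \in unitmx.
Proof.
suff /mulmx1_unit[] : symplectic_mx R p *m (- symplectic_mx R p) = 1%:M by [].
by rewrite mulmxN mul_symplectic_mx opprK.
Qed.

(** * The bivector of a nilpotent structure in a local frame *)

Section NilpotentBundle.
Context {R : realType} {m r n : nat} {M : manifold R m} {E : vbundle M r}.
Variables (h : bilinear_field E) (nabla : connection E) (N : endo_field E).
Hypothesis h_smooth : smooth_bilinear h.
Hypothesis hC : forall x (u w : E x), h x u w = h x w u.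
Hypothesis h_nabla : metric_connection h nabla.
Hypothesis N_smooth : smooth_endo N.
Local Notation J := (symplectic_mx R n).

(** A smooth field of nilpotent frames over [U]. *)
Definition local_nilpotent_frame (U : set M) (q : 'I_(n * 2) -> section E) :
    Prop :=
  [/\ open U, forall a, smooth_section U (q a) &
      forall y, U y -> nilpotent_frame (h y) (N y) (fun a => q a y)].

(** The value of [xi] on the covectors [phi a] with [phi a (N q_b)] equal to 1
    if [a = b] and to 0 otherwise; see [xiE]. *)
Definition xi_scale : R :=
  (-1) ^+ (n * n.-1)./2 / (n`!)%:R * (2 ^- n * pfaffian_sum (- J)).

Lemma xi_scale_neq0 : xi_scale != 0.
Proof.
rewrite /xi_scale pfaffian_sumN !mulf_eq0 !invr_eq0 !signr_eq0 pnatr_eq0.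
rewrite expf_eq0 pnatr_eq0 andbF (gtn_eqF (fact_gt0 n)).
by rewrite (negPf (pfaffian_sum_symplectic_neq0 _ _)).
Qed.

Lemma smooth_near_endo s x :
  smooth_section_near s x -> smooth_section_near (fun y => N y (s y)) x.
Proof. by move=> [U [Uo Ux Us]]; exists U; split=> //; exact: N_smooth. Qed.

Section Frame.
Variables (U : set M) (q : 'I_(n * 2) -> section E).
Hypothesis qP : local_nilpotent_frame U q.

Let Uo : open U. Proof. by have [] := qP. Qed.
Let q_smooth a : smooth_section U (q a).
Proof. by have [_ + _] := qP; apply. Qed.
Let qN y : U y -> nilpotent_frame (h y) (N y) (fun a => q a y).
Proof. by have [_ _ +] := qP; apply. Qed.
Let Nq a : section E := fun y => N y (q a y).
Let Nq_smooth a : smooth_section U (Nq a).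
Proof. exact: N_smooth. Qed.

Lemma Theta_flat y (phi : 'I_2 -> dual (E y)) (t : E y) : U y ->
  phi ord_max = h y t -> Theta h N phi = - phi ord0 (N y t).
Proof.
move=> Uy pt; have qy := qN Uy.
have hK := lker0_lfunK (nilpotent_frame_lker (@hC y) qy).
rewrite /Theta /dual_metric pt [phi ord0](nilpotent_frame_sharp qy).
have -> : (h y t \o N y)%VF = h y (- N y t).
  apply/lfunP => w; rewrite comp_lfunE lfunN opp_lfunE.
  by rewrite (nilpotent_frame_skew (@hC y) qy) opprK.
by rewrite !hK lfunN.
Qed.

Lemma ThetaE y (phi : 'I_2 -> dual (E y)) : U y ->
  Theta h N phi =
  - \sum_a \sum_b J a b * (phi ord0 (Nq a y) * phi ord_max (Nq b y)).
Proof.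
move=> Uy; have qy := qN Uy.
have phiE := nilpotent_frame_sharp qy (phi ord_max).
rewrite (Theta_flat Uy phiE); congr (- _); set t := (X in N y X).
rewrite (nilpotent_frameE qy) lfun_sum; apply: eq_bigr => a _.
rewrite lfun_sum; apply: eq_bigr => b _; rewrite !lfunZ hC -phiE.
by congr (_ * _); rewrite mulrC.
Qed.

(** The matrix of [Theta] on the [phi a] is [- P J P^T], so that its Pfaffian
    sum is [\det P] times that of [- J]. *)
Lemma xiE y (phi : 'I_(n * 2) -> dual (E y)) : U y ->
  xi n h N phi = xi_scale * \det (\matrix_(a, b) (phi a (Nq b y) : R)).
Proof.
move=> Uy; set P : 'M[R]_(n * 2) := \matrix_(a, b) _.
rewrite /xi /xi_scale -[RHS]mulrA; congr (_ * _).
rewrite wedge_power2E -[RHS]mulrA; congr (_ * _).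
rewrite mulrC -pfaffian_sum_congr; apply: eq_bigr => s _; congr (_ * _).
apply: eq_bigr => k _; rewrite (ThetaE _ Uy) mulmxN mulNmx mxE; congr (- _).
rewrite exchange_big mxE; apply: eq_bigr => b _ /=; rewrite !mxE mulr_suml.
by apply: eq_bigr => a _; rewrite !mxE mulrCA mulrA.
Qed.

(** Differentiating [xi_scale * \det (phi_a (N q_b))] row by row, the terms with
    [nabla_v phi_i] cancel and those with [nabla_v (N q_b)] remain. *)
Lemma ext_conn_xi x (v : tangent x) (phi : 'I_(n * 2) -> cosection E) : U x ->
  (forall i, smooth_cosection_near (phi i) x) ->
  ext_conn nabla (xi n h N) phi v =
  xi_scale * \sum_i \det (\matrix_(a, b)
    if a == i then (phi i x (nabla (Nq b) x v) : R) else phi a x (Nq b x)).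
Proof.
move=> Ux phi_smooth.
have Nq_near b : smooth_section_near (Nq b) x by exists U.
have pair_smooth a b : smooth_near (fun y => phi a y (Nq b y) : R) x.
  exact: smooth_near_pairing.
have det_smooth : smooth_near
    (fun y => \det (\matrix_(a, b) (phi a y (Nq b y) : R))) x.
  exact: smooth_near_det.
have xi_near y : U y -> xi n h N (fun i => phi i y) =
    xi_scale * \det (\matrix_(a, b) (phi a y (Nq b y) : R)).
  exact: xiE.
have -> : ext_conn nabla (xi n h N) phi v =
    xi_scale * v (fun y => \det (\matrix_(a, b) (phi a y (Nq b y) : R))) -
    \sum_i xi_scale * \det (\matrix_(a, b)
      if a == i then (dual_conn nabla (phi i) v (Nq b x) : R)
      else phi a x (Nq b x)).
  rewrite /ext_conn -tangentZ//; congr (_ - _).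
    apply: tact_local.
    - have C_smooth := smooth_nearM (smooth_near_cst xi_scale x) det_smooth.
      by apply: (eq_smooth_near Uo Ux _ C_smooth) => y Uy; rewrite xi_near.
    - exact: smooth_nearM (smooth_near_cst xi_scale x) det_smooth.
    - by apply: filterS xi_near _; exact: open_nbhs_nbhs.
  apply: eq_bigr => i _; rewrite (xiE _ Ux); congr (_ * \det _).
  by apply/matrixP => a b; rewrite !mxE; case: ifP.
rewrite tangent_det// -mulr_sumr -mulrBr -sumrB; congr (_ * _).
apply: eq_bigr => i _; apply/eqP; rewrite subr_eq; apply/eqP.
pose A : 'M[R]_(n * 2) := \matrix_(a, b) phi a x (Nq b x).
transitivity (\det (\matrix_(a, b) if a == i then
    (phi i x (nabla (Nq b) x v) : R) + (dual_conn nabla (phi i) v (Nq b x) : R)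
    else A a b)).
  congr (\det _); apply/matrixP => a b; rewrite !mxE; case: eqP => // ->.
  by rewrite (dual_connE nabla)// addrC.
rewrite det_replace_rowD; congr (_ + _); congr (\det _);
by apply/matrixP => a b; rewrite !mxE.
Qed.

(** When every [nabla_v (N q_b)] lies in the image of [N], the trace of the
    matrix of their coefficients on the [N q_a]. *)
Definition frame_trace x (v : tangent x) : R :=
  - \sum_a \sum_b J a b * h x (q b x) (nabla (Nq a) x v).

Lemma ext_conn_xi_trace x (v : tangent x) (phi : 'I_(n * 2) -> cosection E) :
  U x -> (forall b, N x (nabla (Nq b) x v) = 0) ->
  (forall i, smooth_cosection_near (phi i) x) ->
  ext_conn nabla (xi n h N) phi v =
  frame_trace v * xi n h N (fun i => phi i x).
Proof.
move=> Ux NN phi_smooth; rewrite ext_conn_xi// (xiE _ Ux) mulrCA; congr (_ * _).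
pose A : 'M[R]_(n * 2) := \matrix_(a, b) phi a x (Nq b x).
pose B : 'M[R]_(n * 2) := \matrix_(c, b)
  - \sum_d J c d * h x (q d x) (nabla (Nq b) x v).
have -> : frame_trace v = \tr B.
  by rewrite /frame_trace -sumrN; apply: eq_bigr => a _; rewrite mxE.
rewrite -/A -sum_det_replace_row_mul; apply: eq_bigr => i _; congr (\det _).
apply/matrixP => a b; rewrite !mxE; case: eqP => // _.
have qx := qN Ux.
rewrite {1}(nilpotent_frame_ker (@hC x) qx (NN b)) lfun_sum.
by apply: eq_bigr => c _; rewrite !mxE lfunZ mulrC.
Qed.

Let gram_xi x : U x ->
  xi n h N (fun a => h x (q a x)) = xi_scale * \det J.
Proof.
move=> Ux; rewrite (xiE _ Ux); congr (_ * \det _); apply/matrixP => a b.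
by rewrite mxE; have [-> _ _] := qN Ux.
Qed.

Let scaled_det_neq0 : xi_scale * \det J != 0.
Proof.
rewrite mulf_neq0 ?xi_scale_neq0// -unitfE -unitmxE.
exact: symplectic_mx_unit.
Qed.

Let q_near a x : U x -> smooth_section_near (q a) x.
Proof. by move=> Ux; exists U. Qed.

(** A recurrence relation for [xi] determines its factor, as [xi] vanishes
    nowhere. *)
Lemma recurrence_factor_unique x (c c' : R) : U x ->
  (forall phi : 'I_(n * 2) -> cosection E,
    (forall i, smooth_cosection_near (phi i) x) ->
    c * xi n h N (fun i => phi i x) = c' * xi n h N (fun i => phi i x)) ->
  c = c'.
Proof.
move=> Ux cc'; have := cc' (fun a y => h y (q a y)).
rewrite gram_xi// => cJ.
apply: (mulIf scaled_det_neq0); apply: cJ => a.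
by apply: smooth_cosection_near_flat => //; exact: q_near.
Qed.

(** Recurrence is evaluated on the covectors [h(q_a, -)], one of which is
    replaced by [eta = h(N w, -)]. As [eta] vanishes on the image of [N], only one
    determinant survives; it shows that [eta] vanishes on the [nabla_v (N q_b)],
    for every [w]. *)
Lemma recurrent_frame x (v : tangent x) (c : R) : U x ->
  (forall phi : 'I_(n * 2) -> cosection E,
    (forall i, smooth_cosection_near (phi i) x) ->
    ext_conn nabla (xi n h N) phi v = c * xi n h N (fun i => phi i x)) ->
  forall b, N x (nabla (Nq b) x v) = 0.
Proof.
move=> Ux xi_rec b; have qx := qN Ux.
have skew := nilpotent_frame_skew (@hC x) qx.
suff hN0 w b' : h x (N x w) (nabla (Nq b') x v) = 0.
  apply: (nilpotent_frame_nondegenerate qx) => a.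
    by rewrite -[LHS]opprK -skew hN0 oppr0.
  by rewrite skew (nilpotent_frame_sqr qx) linear0 oppr0.
pose eta : cosection E := fun y => h y (N y (extend w y)).
have eta_smooth : smooth_cosection_near eta x.
  apply: smooth_cosection_near_flat => //.
  exact/smooth_near_endo/smooth_section_near_extend.
have etaN a : eta x (Nq a x) = 0.
  by rewrite /eta skew (nilpotent_frame_sqr qx) linear0 oppr0.
pose u : 'rV[R]_(n * 2) := \row_b eta x (nabla (Nq b) x v).
suff u0 : u = 0.
  have := congr1 (fun A : 'rV_(n * 2) => A ord0 b') u0.
  by rewrite !mxE /eta extendE.
suff u_adj : u *m \adj J = 0.
  have := congr1 (mulmx^~ J) u_adj.
  rewrite -mulmxA mul_adj_mx mul0mx mul_mx_scalar => /eqP.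
  rewrite scaler_eq0 => /orP[|/eqP//].
  by rewrite -[_ == 0]negbK -unitfE -unitmxE symplectic_mx_unit.
apply/rowP => i; rewrite mxE [RHS]mxE.
pose phi a : cosection E := if a == i then eta else fun y => h y (q a y).
have phi_smooth a : smooth_cosection_near (phi a) x.
  rewrite /phi; case: ifP => _ //.
  by apply: smooth_cosection_near_flat => //; exact: q_near.
have phiE a c' : phi a x (Nq c' x) = if a == i then 0 else J a c'.
  by rewrite /phi; case: ifP => _; [rewrite etaN|have [-> _ _] := qx].
have := xi_rec _ phi_smooth; rewrite ext_conn_xi// (xiE _ Ux).
rewrite (@det_row0 _ _ _ i) => [|c']; last by rewrite mxE phiE eqxx.
rewrite !mulr0 => /eqP; rewrite mulf_eq0 (negPf xi_scale_neq0) => /eqP.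
rewrite (bigD1 i) //= big1 => [|a /negPf ai]; last first.
  apply: (@det_row0 _ _ _ i) => c'; rewrite mxE eq_sym ai.
  by rewrite phiE eqxx.
rewrite addr0 => det0; transitivity (\det (\matrix_(a, c')
    if a == i then u ord0 c' else J a c')).
  by rewrite det_replace_row; apply: eq_bigr => c' _; rewrite [\adj J _ _]mxE.
rewrite -[RHS]det0; congr (\det _); apply/matrixP => a c'.
rewrite mxE [RHS]mxE; case: ifP => [_|ai]; last by rewrite phiE ai.
by rewrite mxE /phi eqxx.
Qed.

(** For a parallel [N] the matrix [H] of the [h(q_a, nabla_v (N q_b))] is
    symmetric, and its contraction with the antisymmetric [J] vanishes. *)
Lemma parallel_frame_trace x (v : tangent x) : parallel_endo nabla N -> U x ->
  frame_trace v = 0.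
Proof.
move=> parN Ux; have qx := qN Ux; have skew := nilpotent_frame_skew (@hC x) qx.
pose H a b : R := h x (q a x) (nabla (Nq b) x v).
have NqE b : nabla (Nq b) x v = N x (nabla (q b) x v).
  by apply/eqP; rewrite -subr_eq0; apply/eqP/parN/q_near.
have Nq_near b : smooth_section_near (Nq b) x by exists U.
have H_sym a b : H a b = H b a.
  have : v (fun y => h y (q a y) (Nq b y) : R) = 0.
    rewrite -(tangent_cst v (J a b)); apply: tact_local.
    - apply: smooth_near_pairing => //; apply: smooth_cosection_near_flat => //.
      exact: q_near.
    - exact: smooth_near_cst.
    - apply: (@filterS _ _ _ U) => [y Uy|]; last exact: open_nbhs_nbhs.
      by have [-> _ _] := qN Uy.
  rewrite (h_nabla v (q_near a Ux) (Nq_near b)) addrC => /eqP.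
  rewrite addr_eq0 => /eqP; rewrite -/(H a b) => ->.
  by rewrite /H NqE -skew hC.
rewrite /frame_trace; set S := (X in - X).
suff SN : S = - S by apply/eqP; rewrite -SN -eqNr -SN.
rewrite [LHS]exchange_big -sumrN; apply: eq_bigr => a _.
rewrite -sumrN; apply: eq_bigr => b _.
by rewrite symplectic_mxC mulNr -/(H _ _) H_sym.
Qed.

(** For [phi i = h(s i, -)], this is [- h(s 0, (nabla_v N)(s 1))]. *)
Lemma ext_conn_Theta x (v : tangent x) (phi : 'I_2 -> cosection E)
    (s : 'I_2 -> section E) : U x ->
  (forall i, smooth_cosection_near (phi i) x) ->
  (forall i, smooth_section_near (s i) x) ->
  (forall i y, U y -> phi i y = h y (s i y)) ->
  ext_conn nabla (Theta h N) phi v =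
  - h x (s ord0 x)
    (nabla (fun y => N y (s ord_max y)) x v - N x (nabla (s ord_max) x v)).
Proof.
move=> Ux phi_smooth s_smooth phiE.
have nbhsU : nbhs x U by exact: open_nbhs_nbhs.
have dualE i : dual_conn nabla (phi i) v = h x (nabla (s i) x v).
  rewrite -(dual_conn_flat h_smooth)//; apply: near_eq_dual_conn => //.
    exact: smooth_cosection_near_flat.
  by apply: filterS nbhsU => y; exact: phiE.
have Ns_smooth : smooth_section_near (fun y => N y (s ord_max y)) x.
  exact: smooth_near_endo.
have hs_smooth := smooth_near_pairing
  (smooth_cosection_near_flat h_smooth (s_smooth ord0)) Ns_smooth.
have Theta_near y : U y -> - 1 * (h y (s ord0 y) (N y (s ord_max y)) : R) =
    Theta h N (fun i => phi i y).
  move=> Uy; rewrite (Theta_flat (phi := fun i => phi i y) Uy (phiE _ _ Uy)).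
  by rewrite phiE// mulN1r.
have hs_smooth' := smooth_nearM (smooth_near_cst (- 1) x) hs_smooth.
rewrite /ext_conn.
have -> : v (fun y => Theta h N (fun i => phi i y)) =
    v (fun y => - 1 * (h y (s ord0 y) (N y (s ord_max y)) : R)).
  apply: tact_local => //; first exact: (eq_smooth_near Uo Ux Theta_near).
  by apply: filterS nbhsU => y /Theta_near.
rewrite tangentZ// mulN1r (h_nabla v (s_smooth ord0) Ns_smooth).
rewrite big_ord_recl big_ord1.
rewrite (_ : lift ord0 ord0 = ord_max); last exact: val_inj.
rewrite (Theta_flat Ux (t := s ord_max x)) /= ?phiE//.
rewrite (Theta_flat Ux (t := nabla (s ord_max) x v)) /= ?dualE ?phiE//.
by rewrite lfunB -opprD addrACA subrr add0r.
Qed.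

Lemma Theta_parallel_frame x (v : tangent x) : parallel_endo nabla N -> U x ->
  forall phi : 'I_2 -> cosection E,
  (forall i, smooth_cosection_near (phi i) x) ->
  ext_conn nabla (Theta h N) phi v = 0.
Proof.
move=> parN Ux phi phi_smooth.
pose s i : section E := fun y => \sum_a \sum_b J a b *:
  ((phi i y (q a y) : R) *: Nq b y - (phi i y (Nq a y) : R) *: q b y).
have Nq_near b : smooth_section_near (Nq b) x by exists U.
have s_smooth i : smooth_section_near (s i) x.
  apply: smooth_section_near_sum => a; apply: smooth_section_near_sum => b.
  apply: smooth_section_nearZ; first exact: smooth_near_cst.
  apply: smooth_section_nearD.
    apply: smooth_section_nearZ => //.
    by apply: smooth_near_pairing => //; exact: q_near.
  apply: smooth_section_nearN; apply: smooth_section_nearZ; last exact: q_near.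
  exact: smooth_near_pairing.
have phiE i y : U y -> phi i y = h y (s i y).
  by move=> Uy; exact: nilpotent_frame_sharp (qN Uy) _.
by rewrite (ext_conn_Theta v Ux phi_smooth s_smooth phiE) parN// linear0 oppr0.
Qed.

Lemma parallel_Theta_frame x (v : tangent x) (t : section E) : U x ->
  smooth_section_near t x ->
  (forall phi : 'I_2 -> cosection E,
    (forall i, smooth_cosection_near (phi i) x) ->
    ext_conn nabla (Theta h N) phi v = 0) ->
  nabla (fun y => N y (t y)) x v - N x (nabla t x v) = 0.
Proof.
move=> Ux t_smooth Theta0; set z := LHS; have qx := qN Ux.
suff hz w : h x w z = 0.
  by apply: (nilpotent_frame_nondegenerate qx) => a; exact: hz.
pose s (i : 'I_2) : section E := if i == ord0 then extend w else t.
have s_smooth i : smooth_section_near (s i) x.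
  by rewrite /s; case: ifP => _ //; exact: smooth_section_near_extend.
pose phi i : cosection E := fun y => h y (s i y).
have phi_smooth i : smooth_cosection_near (phi i) x.
  exact: smooth_cosection_near_flat.
have := Theta0 phi phi_smooth.
rewrite (ext_conn_Theta v Ux phi_smooth s_smooth)//.
by move/eqP; rewrite oppr_eq0 /s /= extendE => /eqP.
Qed.

(** A local section in the kernel of [N], which is its image, is a combination
    of the [N q_a] with smooth coefficients [c a]. *)
Lemma walker_frame (V : set M) (s : section E) x (v : tangent x) :
  open V -> smooth_section V s -> (forall y, V y -> N y (s y) = 0) ->
  V x -> U x -> (forall b, N x (nabla (Nq b) x v) = 0) ->
  N x (nabla s x v) = 0.
Proof.
move=> Vo Vs Ns Vx Ux NN.
pose c a y : R := - 1 * \sum_b J a b * (h y (q b y) (s y) : R).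
have s_near : smooth_section_near s x by exists V.
have Nq_near b : smooth_section_near (Nq b) x by exists U.
have c_smooth a : smooth_near (c a) x.
  apply: smooth_nearM; first exact: smooth_near_cst.
  apply: smooth_near_sum => b.
  apply: smooth_nearM; first exact: smooth_near_cst.
  apply: smooth_near_pairing => //; apply: smooth_cosection_near_flat => //.
  exact: q_near.
have cN_smooth a : smooth_section_near (fun y => c a y *: Nq a y) x.
  exact: smooth_section_nearZ.
have -> : nabla s x v = nabla (fun y => \sum_a c a y *: Nq a y) x v.
  apply: conn_local => //; first exact: smooth_section_near_sum.
  apply: (@filterS _ _ _ (U `&` V)) => [y [Uy Vy]|]; last first.
    by apply: open_nbhs_nbhs; split=> //; exact: openI.
  rewrite [LHS](nilpotent_frame_ker (@hC y) (qN Uy) (Ns y Vy)).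
  by apply: eq_bigr => a _; rewrite /c mulN1r.
rewrite conn_sum// lfun_sum big1// => a _.
rewrite conn_leibniz// lfunD !lfunZ NN scaler0 addr0.
by rewrite (nilpotent_frame_sqr (qN Ux)) scaler0.
Qed.

Lemma smooth_frame_trace (V : set M) (X : forall x : M, tangent x) :
  open V -> smooth_field V X ->
  smooth_on (V `&` U) (fun x => frame_trace (X x)).
Proof.
move=> Vo VX; have VUo := openI Vo Uo.
have VUX : smooth_field (V `&` U) X.
  by move=> W f Wo WVU; apply: VX => // y /WVU[].
under eq_fun do rewrite /frame_trace -mulN1r.
apply: smooth_onM => //; first exact: smooth_on_cst.
apply: smooth_on_sum => // a; apply: smooth_on_sum => // b.
apply: smooth_onM => //; first exact: smooth_on_cst.
apply: h_smooth => //.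
  by apply: smooth_section_sub (q_smooth b) => y [].
apply: conn_smooth => //.
by apply: smooth_section_sub (Nq_smooth a) => y [].
Qed.

Lemma frame_trace_linear x (a : R) (u v w : tangent x) : U x ->
  tangent_comb a u v w -> frame_trace w = a * frame_trace u + frame_trace v.
Proof.
move=> Ux uvw; rewrite /frame_trace mulrN -opprD mulr_sumr -big_split.
congr (- _); apply: eq_bigr => c _; rewrite mulr_sumr -big_split.
apply: eq_bigr => d _ /=.
have Nq_near : smooth_section_near (Nq c) x by exists U.
by rewrite (conn_tensorial nabla Nq_near uvw) lfunD lfunZ mulrDr mulrCA.
Qed.

End Frame.

End NilpotentBundle.

(** * The Walker condition, recurrence and parallelism *)

Lemma nilpotent_structure_frame (R : realType) (m n : nat) (M : manifold R m)
    (E : vbundle M (rank4 n)) (o : orientation E) (h : bilinear_field E)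
    (eps : bool) (N : endo_field E) : nilpotent_structure o h eps N ->
  forall x, exists2 F : set M * ('I_(n * 2) -> section E),
    F.1 x & local_nilpotent_frame h N F.1 F.2.
Proof.
move=> [_ NP] x; have [U [e [Uo Ux [_ e_smooth] eP]]] := NP x.
pose e' y i := I'_sign R n eps i i *: tnth (e y) i.
exists (U, fun a y => adapted_frame (e' y) a) => //; split=> //= [a|y Uy].
  have e'_smooth i : smooth_section U (fun y => e' y i).
    by apply: smooth_sectionZ => //; exact: smooth_on_cst.
  have half_smooth s : smooth_section U s ->
      smooth_section U (fun y => (2^-1 : R) *: s y).
    by move=> Us; apply: smooth_sectionZ => //; exact: smooth_on_cst.
  rewrite /adapted_frame; case: (odd a); apply: half_smooth.
    by apply: smooth_sectionD => //; exact: smooth_sectionN.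
  exact: smooth_sectionD.
have [[e_basis e_gram] _ Ne] := eP y Uy.
exact: nilpotent_frame_tuple.
Qed.

Theorem proposition3p1 (R : realType) (m n : nat) (n_gt0 : (0 < n)%N)
    (M : manifold R m) (E : vbundle M (rank4 n)) (o : orientation E)
    (h : bilinear_field E) (h_neutral : neutral_metric h)
    (nabla : connection E) (h_nabla : metric_connection h nabla)
    (eps : bool) (N : endo_field E)
    (N_nilp : nilpotent_structure o h eps N) :
  (walker nabla N <->
     exists alpha : one_form M, ext_recurrent nabla (xi n h N) alpha)
  /\
  ((parallel_endo nabla N <-> ext_parallel nabla (Theta h N))
   /\
   (parallel_endo nabla N \/ ext_parallel nabla (Theta h N) ->
      ext_parallel nabla (xi n h N) /\ walker nabla N)).
Proof.
have [h_smooth hC _] := h_neutral; have [N_smooth _] := N_nilp.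
have frame_ex x : exists F : set M * ('I_(n * 2) -> section E),
    F.1 x /\ local_nilpotent_frame h N F.1 F.2.
  by have [F Fx FN] := nilpotent_structure_frame N_nilp x; exists F.
(* [F x] is an open neighborhood of [x] with a field of frames over it. *)
have [F FP] := choice frame_ex.
have Fx x : (F x).1 x by case: (FP x).
have FN x : local_nilpotent_frame h N (F x).1 (F x).2 by case: (FP x).
have NE x y u : (F x).1 y -> (u \in limg (N y)) = (N y u == 0).
  move=> Fy; have [_ _ /(_ y Fy) q] := FN x.
  exact: (nilpotent_frame_limg (@hC y) q).
have frame_walker : (forall x y (v : tangent y), (F x).1 y -> forall b,
    N y (nabla (fun z => N z ((F x).2 b z)) y v) = 0) -> walker nabla N.
  move=> NN V s Vo Vs sN x v Vx; rewrite (NE x)//; apply/eqP.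
  apply: (walker_frame h_smooth hC N_smooth (FN x) Vo Vs) => //.
    by move=> y Vy; apply/eqP; rewrite -(NE y)//; exact: sN.
  exact: NN.
have walker_frameW x y (v : tangent y) : walker nabla N -> (F x).1 y ->
    forall b, N y (nabla (fun z => N z ((F x).2 b z)) y v) = 0.
  move=> W Fy b; apply/eqP; rewrite -(NE x)//.
  have [Uo Fs _] := FN x; apply: (W (F x).1) => //; first exact: N_smooth.
  by move=> z _; apply: memv_img; exact: memvf.
have parallel_Theta : parallel_endo nabla N <-> ext_parallel nabla (Theta h N).
  split=> [parN x v phi phi_smooth|Theta0 t x v t_smooth].
    exact: (Theta_parallel_frame h_smooth hC h_nabla N_smooth (FN x) v parN
      (Fx x)).
  exact: (parallel_Theta_frame h_smooth hC h_nabla N_smooth (FN x) (Fx x)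
    t_smooth (Theta0 x v)).
have parallel_walker : parallel_endo nabla N -> walker nabla N.
  move=> parN; apply: frame_walker => x y v Fy b; have [Uo Fs _] := FN x.
  have q_near : smooth_section_near ((F x).2 b) y by exists (F x).1.
  have /eqP := parN _ _ v q_near; rewrite subr_eq0 => /eqP ->.
  have [_ _ /(_ y Fy) q] := FN x; exact: (nilpotent_frame_sqr q).
split; last split=> //.
- split=> [W|[alpha xi_rec]]; last first.
    apply: frame_walker => x y v Fy.
    exact: (recurrent_frame h_smooth hC N_smooth (FN x) Fy (xi_rec y v)).
  (* At each point the trace is taken in the frame chosen there; by uniqueness
     of the recurrence factor it agrees nearby with the trace in one fixed smooth
     frame, so [beta] is a smooth 1-form. *)
  pose beta x (v : tangent x) := frame_trace h nabla N (F x).2 v.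
  have trace_beta x y (v : tangent y) : (F x).1 y ->
      frame_trace h nabla N (F x).2 v = beta y v.
    move=> Fy; apply: (recurrence_factor_unique h_smooth hC (FN x) Fy).
    move=> phi phi_smooth.
    rewrite -(ext_conn_xi_trace hC N_smooth (FN x))//; last first.
      exact: walker_frameW.
    rewrite -(ext_conn_xi_trace hC N_smooth (FN y))//.
    exact: walker_frameW.
  have beta_linear x a (u v w : tangent x) : tangent_comb a u v w ->
      beta x w = a * beta x u + beta x v.
    exact: (frame_trace_linear nabla N_smooth (FN x) (Fx x)).
  have beta_smooth U (X : forall x : M, tangent x) :
      open U -> smooth_field U X -> smooth_on U (fun x => beta x (X x)).
    move=> Uo UX; apply: smooth_on_local => x Ux.
    exists (U `&` (F x).1), (fun y => frame_trace h nabla N (F x).2 (X y)).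
    split=> //.
      exact: (smooth_frame_trace nabla h_smooth N_smooth (FN x)).
    have [Fo _ _] := FN x.
    apply: (@filterS _ _ _ (F x).1) => [y|]; last exact: open_nbhs_nbhs.
    exact: trace_beta.
  exists (OneForm beta_linear beta_smooth) => x v phi phi_smooth /=.
  apply: (ext_conn_xi_trace hC N_smooth (FN x)) => //.
  exact: walker_frameW.
- move=> par.
  have parN : parallel_endo nabla N by case: par => // /parallel_Theta.
  split; last exact: parallel_walker.
  move=> x v phi phi_smooth.
  rewrite (ext_conn_xi_trace hC N_smooth (FN x))//; last first.
    exact/walker_frameW/Fx/parallel_walker.
  by rewrite (parallel_frame_trace h_smooth hC h_nabla N_smooth (FN x))// mul0r.
Qed.
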